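(* Let $V=V_{\mathrm{ev}}$ (respectively $V=V_{\mathrm{od}}$), and let $\mathrm{Imm}_*=\mathrm{Imm}_{\mathrm{ev}}(S^1,\mathbb C)$ (respectively $\mathrm{Imm}_{\mathrm{od}}(S^1,\mathbb C)$). The map sending an orthonormal pair $(e,f)$ in $V$ without common zeros to the curve $c(\theta)=\tfrac12\int_0^\theta(e(x)+if(x))^2\,dx$ induces, after dividing out by rotations, a map $$\Phi:\mathbf{Gr}^0(2,V)\longrightarrow \mathrm{Imm}_*/(\mathrm{sim}),$$ and this map is an isometry.
   Context: $S^1$ is identified with $\mathbb R/2\pi\mathbb Z$. $V_{\mathrm{ev}}$ is the space of $C^\infty$ functions $f:\mathbb R\to\mathbb R$ with $f(\theta+2\pi)=f(\theta)$; $V_{\mathrm{od}}$ is the space of $C^\infty$ functions $f:\mathbb R\to\mathbb R$ with $f(\theta+2\pi)=-f(\theta)$. Both carry the (weak) inner product $\langle f,g\rangle=\int_0^{2\pi}f(x)g(x)\,dx$. $\mathbf{Gr}(2,V)$ is the Grassmannian of unoriented 2-dimensional subspaces $W$ of $V$, and $\mathbf{Gr}^0(2,V)$ is the subset of those $W$ whose elements have no common zero. Its tangent space at $W$ is $L(W,W^\perp)$, with norm $\|y\|^2=\|y(e)\|^2+\|y(f)\|^2$ for an orthonormal basis $e,f$ of $W$. The rotation $e+if\mapsto e^{i\varphi}(e+if)$ of the basis $(e,f)$ rotates the corresponding curve through the angle $2\varphi$. $\mathrm{Imm}_{\mathrm{ev}}(S^1,\mathbb C)$ and $\mathrm{Imm}_{\mathrm{od}}(S^1,\mathbb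 C)$ are the spaces of $C^\infty$ immersions $c:S^1\to\mathbb C$ of even, respectively odd, rotation degree (the winding number of $c'$ around $0$). ''sim'' is the group of similitudes of $\mathbb C$ generated by translations, rotations and scalings. With $\ell(c)$ the length of $c$, $ds=|c_\theta|\,d\theta$ and $D_s=|c_\theta|^{-1}\partial_\theta$, the metric on $\mathrm{Imm}_*/(\text{translations})$ is $$G_c(h,h)=\frac1{\ell(c)}\int_{S^1}|D_sh|^2\,ds$$ for $h:S^1\to\mathbb C$ modulo constants. It is invariant under rotations and scalings, and $\mathrm{Imm}_*/(\mathrm{sim})$ carries the induced quotient metric (restrict $G$ to $\{c: c(0)=0,\ \ell(c)=1\}$ and take the quotient by rotations as a Riemannian submersion).
   Formalization: Since (e,f) and (e,-f) give conjugate curves, planes are taken oriented, or else unoriented with reflections added to sim (both are proved); and Φ is an isometry for twice the stated metric on the Grassmannian, as G_c(h,h) = 2‖y‖² with these normalisations. *)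

(* Defs.v *)
From Stdlib Require Import Reals.
From Coquelicot Require Import Coquelicot.

Open Scope R_scope.

(** * Weak Riemannian spaces

    The spaces below are quotients of open subsets, or submanifolds, of
    Frechet spaces.  Their smooth structure is recorded by their smooth curves:
    a map between such manifolds is smooth iff it sends smooth curves to smooth
    curves.  [velocity g t v] says that [v] is the derivative of [g] at time
    [t], and [normsq p v q] that [v], tangent at [p], has squared norm [q]. *)

Record weak_riemannian := WeakRiemannian {
  point : Type;
  smooth_curve : (R -> point) -> Prop;
  tangent : point -> Type;
  velocity : forall (g : R -> point) (t : R), tangent (g t) -> Prop;
  normsq : forall p : point, tangent p -> R -> Prop
}.

Definition smooth_map (X Y : weak_riemannian) (F : point X -> point Y) : Prop :=
  forall g, smooth_curve X g -> smooth_curve Y (fun s => F (g s)).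

Definition diffeomorphism (X Y : weak_riemannian) (F : point X -> point Y)
  : Prop :=
  smooth_map X Y F /\
  exists G : point Y -> point X,
    smooth_map Y X G /\
    (forall x, G (F x) = x) /\ (forall y, F (G y) = y).

Definition tangent_map (X Y : weak_riemannian) (F : point X -> point Y)
    (TF : forall x, tangent X x -> tangent Y (F x)) : Prop :=
  forall g t v, smooth_curve X g ->
    velocity X g t v -> velocity Y (fun s => F (g s)) t (TF (g t) v).

Definition isometry (X Y : weak_riemannian) (F : point X -> point Y) : Prop :=
  diffeomorphism X Y F /\
  exists TF : forall x, tangent X x -> tangent Y (F x),
    tangent_map X Y F TF /\
    forall x v q, normsq X x v q <-> normsq Y (F x) (TF x v) q.

(** The same space with its metric tensor multiplied by [k]. *)
Definition rescale (k : R) (X : weak_riemannian) : weak_riemannian :=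
  WeakRiemannian (point X) (smooth_curve X) (tangent X) (velocity X)
    (fun p v q => exists q', normsq X p v q' /\ q = k * q').

(** * The spaces [V_ev] and [V_od] *)

Inductive parity := even | odd.

Definition smooth (f : R -> R) : Prop := forall n x, ex_derive_n f n x.

Definition smooth2 (u : R -> R -> R) : Prop := forall n s x, ex_diff_n u n s x.

Definition inV (p : parity) (f : R -> R) : Prop :=
  smooth f /\
  forall x, f (x + 2 * PI) = match p with even => f x | odd => - f x end.

Definition inner (f g : R -> R) : R := RInt (fun x => f x * g x) 0 (2 * PI).

Definition lincomb (a : R) (f : R -> R) (b : R) (g : R -> R) : R -> R :=
  fun x => a * f x + b * g x.

Definition orthonormal (e f : R -> R) : Prop :=
  inner e e = 1 /\ inner f f = 1 /\ inner e f = 0.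

(** * Grassmannians

    Throughout, the flag [r] tells whether orientation-reversing changes are
    divided out: [r = true] gives unoriented planes (bases modulo GL(2)) and
    [r = false] gives oriented planes (bases modulo GL+(2)).  An orientation is
    given by its set of positive bases; if [r = true], [frames] is the set of
    all bases of [carrier] and carries no further information. *)

Record plane := Plane {
  carrier : (R -> R) -> Prop;
  frames : (R -> R) -> (R -> R) -> Prop
}.

Definition admissible_det (r : bool) (d : R) : Prop :=
  if r then d <> 0 else 0 < d.

Definition is_plane (r : bool) (p : parity) (W : plane) : Prop :=
  exists e f : R -> R,
    inV p e /\ inV p f /\
    (forall a b, (forall x, lincomb a e b f x = 0) -> a = 0 /\ b = 0) /\
    (forall u, carrier W u <-> exists a b, u = lincomb a e b f) /\
    (forall u v, frames W u v <-> exists a b a' b',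
       u = lincomb a e b f /\ v = lincomb a' e b' f /\
       admissible_det r (a * b' - b * a')).

Definition no_common_zero (W : plane) : Prop :=
  ~ exists x, forall u, carrier W u -> u x = 0.

Definition Gr0 (r : bool) (p : parity) : Type :=
  {W : plane | is_plane r p W /\ no_common_zero W}.

Definition orthonormal_frame (W : plane) (e f : R -> R) : Prop :=
  frames W e f /\ orthonormal e f.

(** [L(W, W^perp)], the orthogonal complement being taken in [V]. *)
Record hom_perp (p : parity) (W : plane) := HomPerp {
  hom_fun :> {u | carrier W u} -> R -> R;
  hom_inV : forall u, inV p (hom_fun u);
  hom_perpP : forall u w, carrier W w -> inner (hom_fun u) w = 0;
  hom_linear : forall (a b : R) (u v w : {u | carrier W u}),
    proj1_sig w = lincomb a (proj1_sig u) b (proj1_sig v) ->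
    hom_fun w = lincomb a (hom_fun u) b (hom_fun v)
}.

Definition hom_normsq (p : parity) (W : plane) (y : hom_perp p W) (q : R)
  : Prop :=
  exists e f : {u | carrier W u},
    orthonormal (proj1_sig e) (proj1_sig f) /\
    q = inner (y e) (y e) + inner (y f) (y f).

(** A smooth curve in a space of smooth functions of [x] is a function of
    [(s, x)] that is jointly smooth. *)
Definition frame_lift (r : bool) (p : parity) (g : R -> Gr0 r p)
    (e f : R -> R -> R) : Prop :=
  smooth2 e /\ smooth2 f /\
  forall s, orthonormal_frame (proj1_sig (g s)) (e s) (f s).

Definition time_derive (u : R -> R -> R) (t : R) : R -> R :=
  fun x => Derive (fun s => u s x) t.

(** [y] maps the value [u t] of each member [u] of a lifted frame to the
    orthogonal projection on [W^perp] of its time derivative. *)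
Definition Gr0_velocity (r : bool) (p : parity) (g : R -> Gr0 r p) (t : R)
    (y : hom_perp p (proj1_sig (g t))) : Prop :=
  exists e f, frame_lift r p g e f /\
    forall w : {u | carrier (proj1_sig (g t)) u},
      (proj1_sig w = e t ->
         carrier (proj1_sig (g t)) (fun x => time_derive e t x - y w x)) /\
      (proj1_sig w = f t ->
         carrier (proj1_sig (g t)) (fun x => time_derive f t x - y w x)).

Definition GrassmannR (r : bool) (p : parity) : weak_riemannian :=
  WeakRiemannian (Gr0 r p)
    (fun g => exists e f, frame_lift r p g e f)
    (fun W => hom_perp p (proj1_sig W))
    (Gr0_velocity r p)
    (fun W => hom_normsq p (proj1_sig W)).

(** * Immersed closed curves *)

Definition csmooth (c : R -> C) : Prop :=
  smooth (fun x => Re (c x)) /\ smooth (fun x => Im (c x)).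

Definition csmooth2 (c : R -> R -> C) : Prop :=
  smooth2 (fun s x => Re (c s x)) /\ smooth2 (fun s x => Im (c s x)).

Definition Dtheta (c : R -> C) : R -> C :=
  fun x => (Derive (fun y => Re (c y)) x, Derive (fun y => Im (c y)) x).

Definition periodic (c : R -> C) : Prop := forall x, c (x + 2 * PI) = c x.

(** Winding number around 0 of a loop, as the imaginary part of the integral
    of [dz / z]. *)
Definition winding_number (z : R -> C) (k : Z) : Prop :=
  RInt (fun x => Im (Dtheta z x / z x)%C) 0 (2 * PI) = 2 * PI * IZR k.

Definition Imm (p : parity) (c : R -> C) : Prop :=
  csmooth c /\ periodic c /\ (forall x, Dtheta c x <> 0%C) /\
  exists k : Z, winding_number (Dtheta c) k /\
    match p with even => Z.Even k | odd => Z.Odd k end.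

Definition curve_length (c : R -> C) : R :=
  RInt (fun x => Cmod (Dtheta c x)) 0 (2 * PI).

Definition expi (a : R) : C := (cos a, sin a).

(** Similitudes of the plane; reflections are included iff [r = true]. *)
Inductive similitude (r : bool) : (C -> C) -> Prop :=
| sim_translation : forall b : C, similitude r (fun z => z + b)%C
| sim_rotation : forall a : R, similitude r (fun z => expi a * z)%C
| sim_scaling : forall l : R, 0 < l -> similitude r (fun z => RtoC l * z)%C
| sim_reflection : r = true -> similitude r Cconj
| sim_comp : forall g h, similitude r g -> similitude r h ->
    similitude r (fun z => g (h z)).

Definition sim_class (r : bool) (p : parity) (c : R -> C) : (R -> C) -> Prop :=
  fun c' => Imm p c' /\
    exists g, similitude r g /\ c' = (fun x => g (c x)).

Definition ImmSim (r : bool) (p : parity) : Type :=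
  {A : (R -> C) -> Prop | exists c, Imm p c /\ A = sim_class r p c}.

(** The metric [G], polarized, so that [G c h h] is the integral of
    [|D_s h|^2 ds] divided by the length of [c]. *)
Definition Ds (c h : R -> C) : R -> C :=
  fun x => (Dtheta h x / RtoC (Cmod (Dtheta c x)))%C.

Definition G (c h k : R -> C) : R :=
  / curve_length c *
  RInt (fun x => Re (Ds c h x * Cconj (Ds c k x))%C * Cmod (Dtheta c x))
    0 (2 * PI).

(** The slice [c 0 = 0], [curve_length c = 1], which meets every similarity class in
    one orbit of rotations (and reflections if [r = true]). *)
Definition normalized (p : parity) (c : R -> C) : Prop :=
  Imm p c /\ c 0 = 0%C /\ curve_length c = 1.

(** Tangent space of the slice at [c]; the derivative of the length at [c] in
    direction [h] is [curve_length c * G c h c]. *)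
Definition slice_tangent (c h : R -> C) : Prop :=
  csmooth h /\ periodic h /\ h 0 = 0%C /\ G c h c = 0.

Inductive orthogonal_map (r : bool) : (C -> C) -> Prop :=
| orth_rotation : forall a : R, orthogonal_map r (fun z => expi a * z)%C
| orth_reflection : forall a : R, r = true ->
    orthogonal_map r (fun z => expi a * Cconj z)%C.

(** The direction of the rotation orbit at [c]. *)
Definition rot_dir (c : R -> C) : R -> C := fun x => (Ci * c x)%C.

(** A tangent vector of the quotient of the slice: the set of all pairs of a
    point of an orbit and a vector tangent to the slice there, that project to
    the same vector as [(c, h)]. *)
Definition tangent_class (r : bool) (c h : R -> C)
  : (R -> C) -> (R -> C) -> Prop :=
  fun c' h' => exists (L : C -> C) (a : R), orthogonal_map r L /\
    c' = (fun x => L (c x)) /\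
    h' = (fun x => L (h x + RtoC a * rot_dir c x)%C).

Definition ImmSim_tangent (r : bool) (p : parity) (A : ImmSim r p) : Type :=
  {T : (R -> C) -> (R -> C) -> Prop |
     exists c h, proj1_sig A c /\ normalized p c /\ slice_tangent c h /\
       T = tangent_class r c h}.

(** Quotient metric: the norm of the horizontal representatives. *)
Definition ImmSim_normsq (r : bool) (p : parity) (A : ImmSim r p)
    (T : ImmSim_tangent r p A) (q : R) : Prop :=
  exists c h, proj1_sig T c h /\ G c h (rot_dir c) = 0 /\ q = G c h h.

Definition normalized_lift (r : bool) (p : parity) (g : R -> ImmSim r p)
    (c : R -> R -> C) : Prop :=
  csmooth2 c /\ forall s, normalized p (c s) /\ proj1_sig (g s) (c s).

Definition ctime_derive (c : R -> R -> C) (t : R) : R -> C :=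
  fun x => (Derive (fun s => Re (c s x)) t, Derive (fun s => Im (c s x)) t).

Definition ImmSim_velocity (r : bool) (p : parity) (g : R -> ImmSim r p)
    (t : R) (T : ImmSim_tangent r p (g t)) : Prop :=
  exists c, normalized_lift r p g c /\ proj1_sig T (c t) (ctime_derive c t).

Definition ImmSimR (r : bool) (p : parity) : weak_riemannian :=
  WeakRiemannian (ImmSim r p)
    (fun g => exists c, normalized_lift r p g c)
    (ImmSim_tangent r p)
    (ImmSim_velocity r p)
    (ImmSim_normsq r p).

(** * The basic mapping *)

Definition basic_curve (e f : R -> R) : R -> C := fun theta =>
  (RtoC (/ 2) *
   RInt (V := C_R_CompleteNormedModule)
     (fun x => (RtoC (e x) + Ci * RtoC (f x)) *
               (RtoC (e x) + Ci * RtoC (f x)))%C 0 theta)%C.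

(** [F] sends each plane to the similarity class of the curves given by its
    (positive) orthonormal bases.  The bases [(e, f)] and [(e, - f)] of one
    subspace give complex conjugate curves, which are not related by rotations,
    translations and scalings: hence the flag [r] has to be the same on both
    sides.

    With [w = e + i f] and a variation [dw], the curve varies by [h] with
    [h' = w dw], while [c' = w ^ 2 / 2]; so [|D_s h|^2 ds = 2 |dw|^2 dtheta],
    and the metrics correspond up to the constant factor 2. *)
Definition induced_by_basic_curve (r : bool) (p : parity)
    (F : Gr0 r p -> ImmSim r p) : Prop :=
  forall (W : Gr0 r p) (e f : R -> R),
    orthonormal_frame (proj1_sig W) e f ->
    proj1_sig (F W) (basic_curve e f).

(* Main.v *)
Require Import Defs.
From Stdlib Require Import Reals.
From Stdlib Require Import Lra Lia ZArith.
From Stdlib Require Import FunctionalExtensionality PropExtensionality ClassicalEpsilon.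
From Coquelicot Require Import Coquelicot.
Open Scope R_scope.

(** Write [w = e + i f], so that the basic curve has [c' = w ^ 2 / 2].  A family of
    immersions is lifted back by taking a smooth square root of [2 c'] in polar
    coordinates; the parity of the winding number of [c'] is exactly the sign in
    [w (x + 2 PI) = +/- w x], and closedness and unit length of [c] say that
    [(e, f)] is orthonormal.  The root is unique up to sign, and a similitude of
    [c] multiplies [w] by a unit complex number (after conjugation, for a
    reflection), i.e. it changes the orthonormal frame of the same plane.  A
    variation [dw] gives [h' = w dw] and [G c h h = 2 |dw| ^ 2]; [dw] is orthogonal
    to the plane iff [h] is tangent to the slice and orthogonal to the rotation
    orbit, while the remaining infinitesimal rotation of the frame moves [c] along
    that orbit. *)

(** Smoothness is tested on one-parameter families, so the inverse map needs a square root of [2 c']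
    that is jointly smooth in the parameter [s] and in [x]; one root per curve is not enough.
    Branches of the argument would give it only locally. Integrating the logarithmic derivative
    along paths in the [(s, x)]-plane gives it globally, which is why the closure of [smooth2] under
    primitives is the analytic core.

    Conjugation is allowed only when [r = true]. A sign [sigma] carries it through the whole
    computation: it is the determinant of an orthogonal change of frame, the reflection part of a
    similitude, and the factor by which the direction of rotation is reversed. Both values of [r]
    are thus handled together.

    No plane has a canonical orthonormal frame. The map and its tangent map are therefore defined at
    a chosen frame, and an arbitrary lifted frame is compared with it through [turn1] and [turn2]. A
    frame rotated by [phi] gives a curve rotated by [2 * phi]; this doubling accounts for the half
    angles that appear below. *)

(** * Derivatives and continuity of real functions *)

Lemma is_derive_Rmult (f g : R -> R) (x a b : R) :
  is_derive f x a -> is_derive g x b ->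
  is_derive (fun y => f y * g y) x (a * g x + f x * b).
Proof.
  intros Hf Hg.
  apply (is_derive_mult f g x a b Hf Hg).
  intros; apply Rmult_comm.
Qed.

Lemma is_derive_Rplus (f g : R -> R) (x a b : R) :
  is_derive f x a -> is_derive g x b ->
  is_derive (fun y => f y + g y) x (a + b).
Proof. exact (is_derive_plus f g x a b). Qed.

Lemma is_derive_Rcomp (f g : R -> R) (x a b : R) :
  is_derive f (g x) a -> is_derive g x b ->
  is_derive (fun y => f (g y)) x (a * b).
Proof.
  intros Hf Hg. rewrite Rmult_comm.
  exact (is_derive_comp f g x a b Hf Hg).
Qed.

Lemma is_derive_value (f : R -> R) (x a b : R) :
  is_derive f x a -> a = b -> is_derive f x b.
Proof. now intros H <-. Qed.

Lemma is_derive_continuity_pt (f : R -> R) (x l : R) :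
  is_derive f x l -> continuity_pt f x.
Proof.
  intros H. apply continuity_pt_filterlim.
  apply (ex_derive_continuous f x). now exists l.
Qed.

Lemma is_derive_0_const (f : R -> R) :
  (forall x, is_derive f x 0) -> forall x y, f x = f y.
Proof.
  intros H x y. destruct (total_order_T x y) as [[h|h]|h].
  - apply eq_is_derive with (2 := h); intros; apply H.
  - now rewrite h.
  - symmetry. apply eq_is_derive with (2 := h); intros; apply H.
Qed.

Lemma continuity_2d_pt_x (u : R -> R -> R) (s x : R) :
  continuity_2d_pt u s x -> continuous (u s) x.
Proof.
  intros H. apply continuity_pt_filterlim. intros eps Heps.
  destruct (H (mkposreal eps Heps)) as [d Hd].
  exists d; split; [apply d|]. intros y [_ Hy].
  apply Hd; [|exact Hy].
  rewrite Rminus_diag, Rabs_R0; apply d.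
Qed.

(** * Smooth functions of one and two variables *)

Definition prim (f : R -> R) : R -> R := fun x => RInt f 0 x.

Lemma ex_RInt_cont (f : R -> R) (a b : R) :
  (forall x, continuous f x) -> ex_RInt f a b.
Proof.
  intros H. apply (ex_RInt_continuous f). intros; apply H.
Qed.

Lemma is_derive_prim (f : R -> R) (x : R) :
  (forall y, continuous f y) -> is_derive (prim f) x (f x).
Proof.
  intros H. apply (is_derive_RInt f (prim f) 0 x); [|apply H].
  apply filter_forall. intros y.
  apply (RInt_correct f), ex_RInt_cont, H.
Qed.

Lemma prim_0 (f : R -> R) : prim f 0 = 0.
Proof. unfold prim. now rewrite RInt_point. Qed.

Lemma Derive_n_Derive (f : R -> R) (n : nat) (x : R) :
  Derive_n (Derive f) n x = Derive_n f (S n) x.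
Proof.
  replace (S n) with (n + 1)%nat by lia.
  exact (Derive_n_comp f n 1 x).
Qed.

(** Induction on the order of differentiation, over all of [P] at once: an invariant class, such as
    the combinations of [sin] and [cos], replaces formulas for the higher derivatives. *)
Lemma smooth_ind (P : (R -> R) -> Prop) :
  (forall f, P f -> exists g, P g /\ forall x, is_derive f x (g x)) ->
  forall f, P f -> smooth f.
Proof.
  intros HP f Hf n x. revert f Hf. induction n as [|n IH]; intros f Hf.
  - exact I.
  - destruct (HP f Hf) as [g [Hg Hd]].
    assert (E : Derive f = g).
    { apply functional_extensionality. intros y.
      apply is_derive_unique, Hd. }
    destruct n as [|n].
    + simpl. exists (g x). apply Hd.
    + generalize (IH g Hg). rewrite <- E.
      apply (ex_derive_ext (Derive_n (Derive f) n)). intros y.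
      apply Derive_n_Derive.
Qed.

Lemma smooth_Derive (f : R -> R) :
  smooth f -> smooth (Derive f) /\ forall x, is_derive f x (Derive f x).
Proof.
  intros Hf. split.
  - intros n x. destruct n as [|n]; [exact I|].
    generalize (Hf (S (S n)) x).
    apply (ex_derive_ext (Derive_n f (S n))). intros y.
    symmetry. apply Derive_n_Derive.
  - intros x. apply Derive_correct. exact (Hf 1%nat x).
Qed.

Lemma smooth_continuous (f : R -> R) (x : R) : smooth f -> continuous f x.
Proof.
  intros Hf. apply (ex_derive_continuous f x). exact (Hf 1%nat x).
Qed.

(** Two-variable analogue of [smooth_ind]. Continuity belongs to the invariant because [ex_diff_n]
    asks for it at every order, and the existence of partial derivatives does not give joint
    continuity. *)
Lemma smooth2_coind (P : (R -> R -> R) -> Prop) :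
  (forall u, P u ->
     (forall s x, continuity_2d_pt u s x) /\
     (exists us, P us /\ forall s x, is_derive (fun z => u z x) s (us s x)) /\
     (exists ux, P ux /\ forall s x, is_derive (u s) x (ux s x))) ->
  forall u, P u -> smooth2 u.
Proof.
  intros HP u Hu n s x. revert u Hu s x.
  induction n as [|n IH]; intros u Hu s x;
    destruct (HP u Hu) as [Hc [[us [Hus Hs]] [ux [Hux Hx]]]].
  - split; [apply Hc|exact I].
  - split; [apply Hc|]. split; [exists (us s x); apply Hs|].
    split; [exists (ux s x); apply Hx|]. split.
    + replace (fun u0 v : R => Derive (fun z : R => u z v) u0) with us.
      * now apply IH.
      * do 2 (apply functional_extensionality; intros ?).
        symmetry. apply is_derive_unique, Hs.
    + replace (fun u0 v : R => Derive (fun z : R => u u0 z) v) with ux.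
      * now apply IH.
      * do 2 (apply functional_extensionality; intros ?).
        symmetry. apply is_derive_unique, Hx.
Qed.

Definition pds (u : R -> R -> R) : R -> R -> R :=
  fun s x => Derive (fun z => u z x) s.
Definition pdx (u : R -> R -> R) : R -> R -> R := fun s x => Derive (u s) x.

Lemma smooth2_cont (u : R -> R -> R) (s x : R) :
  smooth2 u -> continuity_2d_pt u s x.
Proof. intros H. apply (H 0%nat s x). Qed.

Lemma smooth2_pds (u : R -> R -> R) :
  smooth2 u -> smooth2 (pds u) /\
    forall s x, is_derive (fun z => u z x) s (pds u s x).
Proof.
  intros H. split.
  - intros n s x. apply (H (S n) s x).
  - intros s x. apply Derive_correct. apply (H 1%nat s x).
Qed.

Lemma smooth2_pdx (u : R -> R -> R) :
  smooth2 u -> smooth2 (pdx u) /\ forall s x, is_derive (u s) x (pdx u s x).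
Proof.
  intros H. split.
  - intros n s x. apply (H (S n) s x).
  - intros s x. apply Derive_correct. apply (H 1%nat s x).
Qed.

Lemma smooth2_continuous (u : R -> R -> R) (s x : R) :
  smooth2 u -> continuous (u s) x.
Proof. intros H. now apply continuity_2d_pt_x, smooth2_cont. Qed.

Lemma smooth2_smooth (u : R -> R -> R) (s : R) : smooth2 u -> smooth (u s).
Proof.
  intros H.
  apply (smooth_ind (fun f => exists v, smooth2 v /\ f = v s));
    [|now exists u].
  intros f [v [Hv ->]]. destruct (smooth2_pdx v Hv) as [H1 H2].
  exists (pdx v s). split; [now exists (pdx v)|]. apply H2.
Qed.

(** Single products are not closed under differentiation, whereas expressions built from smooth
    functions are. One application of [smooth2_coind] to this class then yields all the algebraic
    closure properties. *)
Inductive smooth_expr : (R -> R -> R) -> Prop :=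
| se_base u : smooth2 u -> smooth_expr u
| se_const k : smooth_expr (fun _ _ => k)
| se_plus u v : smooth_expr u -> smooth_expr v ->
    smooth_expr (fun s x => u s x + v s x)
| se_mult u v : smooth_expr u -> smooth_expr v ->
    smooth_expr (fun s x => u s x * v s x)
| se_inv u : (forall s x, u s x <> 0) -> smooth_expr u ->
    smooth_expr (fun s x => / u s x)
| se_comp f u : smooth f -> smooth_expr u -> smooth_expr (fun s x => f (u s x)).

Ltac se_tac := repeat first
  [ assumption | apply se_base; assumption | apply se_plus | apply se_mult
  | apply se_inv | apply se_const ].

Lemma smooth_expr_smooth2 (u : R -> R -> R) : smooth_expr u -> smooth2 u.
Proof.
  apply smooth2_coind. clear u.
  intros u Hu.
  induction Hu as [u Hu|k|u v Hu [Hc [[us [Is Hs]] [ux [Ix Hx]]]]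
      Hv [Hc' [[vs [Js Ks]] [vx [Jx Kx]]]]
    |u v Hu [Hc [[us [Is Hs]] [ux [Ix Hx]]]]
      Hv [Hc' [[vs [Js Ks]] [vx [Jx Kx]]]]
    |u H0 Hu [Hc [[us [Is Hs]] [ux [Ix Hx]]]]
    |f u Hf Hu [Hc [[us [Is Hs]] [ux [Ix Hx]]]]].
  - destruct (smooth2_pds u Hu), (smooth2_pdx u Hu). repeat split.
    + intros; now apply smooth2_cont.
    + exists (pds u). split; [now apply se_base|assumption].
    + exists (pdx u). split; [now apply se_base|assumption].
  - repeat split.
    + intros; apply continuity_2d_pt_const.
    + exists (fun _ _ => 0). split; [apply se_const|].
      intros s x; exact (is_derive_const k s).
    + exists (fun _ _ => 0). split; [apply se_const|].
      intros s x; exact (is_derive_const k x).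
  - repeat split.
    + intros; now apply continuity_2d_pt_plus.
    + exists (fun s x => us s x + vs s x). split; [se_tac|].
      intros; now apply (is_derive_Rplus (fun z => u z x) (fun z => v z x)).
    + exists (fun s x => ux s x + vx s x). split; [se_tac|].
      intros; now apply (is_derive_Rplus (u s) (v s)).
  - repeat split.
    + intros; now apply continuity_2d_pt_mult.
    + exists (fun s x => us s x * v s x + u s x * vs s x).
      split; [se_tac|].
      intros; now apply (is_derive_Rmult (fun z => u z x) (fun z => v z x)).
    + exists (fun s x => ux s x * v s x + u s x * vx s x).
      split; [se_tac|].
      intros; now apply (is_derive_Rmult (u s) (v s)).
  - repeat split.
    + intros; now apply continuity_2d_pt_inv.
    (* The derivative [- us / u^2] is spelled with products and inverses so that it stays a
       [smooth_expr]. *)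
    + exists (fun s x => -1 * us s x * (/ u s x * / u s x)).
      split; [se_tac|].
      intros. eapply is_derive_value;
        [apply (is_derive_inv (fun z => u z x) s (us s x)); auto|].
      field; auto.
    + exists (fun s x => -1 * ux s x * (/ u s x * / u s x)).
      split; [se_tac|].
      intros. eapply is_derive_value;
        [apply (is_derive_inv (u s) x (ux s x)); auto|].
      field; auto.
  - destruct (smooth_Derive f Hf) as [Hf' Df].
    repeat split.
    + intros; apply continuity_1d_2d_pt_comp; [|apply Hc].
      eapply is_derive_continuity_pt, Df.
    + exists (fun s x => Derive f (u s x) * us s x).
      split; [se_tac; now apply se_comp|].
      intros; now apply (is_derive_Rcomp f (fun z => u z x)).
    + exists (fun s x => Derive f (u s x) * ux s x).
      split; [se_tac; now apply se_comp|].
      intros; now apply (is_derive_Rcomp f (u s)).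
Qed.

Lemma smooth2_const (k : R) : smooth2 (fun _ _ => k).
Proof. apply smooth_expr_smooth2, se_const. Qed.

Lemma smooth2_plus (u v : R -> R -> R) :
  smooth2 u -> smooth2 v -> smooth2 (fun s x => u s x + v s x).
Proof. intros; apply smooth_expr_smooth2; se_tac. Qed.

Lemma smooth2_mult (u v : R -> R -> R) :
  smooth2 u -> smooth2 v -> smooth2 (fun s x => u s x * v s x).
Proof. intros; apply smooth_expr_smooth2; se_tac. Qed.

Lemma smooth2_opp (u : R -> R -> R) :
  smooth2 u -> smooth2 (fun s x => - u s x).
Proof.
  intros H.
  replace (fun s x => - u s x) with (fun s x => -1 * u s x).
  - apply (smooth2_mult (fun _ _ => -1)); auto using smooth2_const.
  - do 2 (apply functional_extensionality; intros ?). ring.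
Qed.

Lemma smooth2_minus (u v : R -> R -> R) :
  smooth2 u -> smooth2 v -> smooth2 (fun s x => u s x - v s x).
Proof.
  intros Hu Hv. apply (smooth2_plus u (fun s x => - v s x)); auto.
  now apply smooth2_opp.
Qed.

Lemma smooth2_div (u v : R -> R -> R) : (forall s x, v s x <> 0) ->
  smooth2 u -> smooth2 v -> smooth2 (fun s x => u s x / v s x).
Proof.
  intros; apply smooth_expr_smooth2; unfold Rdiv; se_tac.
Qed.

Lemma smooth2_comp (f : R -> R) (u : R -> R -> R) :
  smooth f -> smooth2 u -> smooth2 (fun s x => f (u s x)).
Proof.
  intros; apply smooth_expr_smooth2, se_comp; se_tac.
Qed.

Lemma smooth_exp : smooth exp.
Proof.
  apply (smooth_ind (fun f => f = exp)); [|reflexivity].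
  intros f ->. exists exp; split; [reflexivity|]. apply is_derive_exp.
Qed.

Lemma smooth_sin_cos : smooth sin /\ smooth cos.
Proof.
  assert (H : forall f, (exists a b, f = fun x => a * sin x + b * cos x) ->
     smooth f).
  { apply smooth_ind. intros f [a [b ->]].
    exists (fun x => - b * sin x + a * cos x). split; [now eexists; eexists|].
    intros x. auto_derive; [trivial|ring]. }
  split; apply H; [exists 1, 0|exists 0, 1];
    apply functional_extensionality; intros; ring.
Qed.

Lemma smooth_smooth2 (f : R -> R) : smooth f -> smooth2 (fun _ x => f x).
Proof.
  intros Hf.
  apply (smooth2_coind (fun u => exists g, smooth g /\ u = fun _ x => g x));
    [|now exists f].
  intros u [g [Hg ->]]. destruct (smooth_Derive g Hg) as [H1 H2].
  repeat split.
  - intros. apply (continuity_1d_2d_pt_comp g (fun _ x => x)).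
    + eapply is_derive_continuity_pt, H2.
    + apply continuity_2d_pt_id2.
  - exists (fun _ _ => 0). split.
    + exists (fun _ => 0). split; [|reflexivity].
      exact (smooth2_smooth _ 0 (smooth2_const 0)).
    + intros s x. exact (is_derive_const (g x) s).
  - exists (fun _ x => Derive g x). split; [now exists (Derive g)|].
    intros. apply H2.
Qed.

(** Serves to treat functions of [s] alone as functions of the pair, and to restrict a function of
    the pair to fixed [x]. *)
Lemma smooth2_swap (u : R -> R -> R) :
  smooth2 u -> smooth2 (fun s x => u x s).
Proof.
  intros Hu.
  apply (smooth2_coind (fun v => exists w, smooth2 w /\ v = fun s x => w x s));
    [|now exists u].
  intros v [w [Hw ->]].
  destruct (smooth2_pds w Hw) as [H1 H2], (smooth2_pdx w Hw) as [H3 H4].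
  repeat split.
  - intros s x eps. destruct (smooth2_cont w x s Hw eps) as [d Hd].
    exists d. intros a b Ha Hb. now apply Hd.
  - exists (fun s x => pdx w x s). split; [now exists (pdx w)|].
    intros; apply H4.
  - exists (fun s x => pds w x s). split; [now exists (pds w)|].
    intros; apply H2.
Qed.

Lemma is_derive_prim_param (u : R -> R -> R) (s x : R) :
  smooth2 u -> is_derive (fun z => prim (u z) x) s (prim (pds u s) x).
Proof.
  intros Hu. destruct (smooth2_pds u Hu) as [H1 H2].
  apply (is_derive_RInt_param (fun z y => u z y) 0 x s).
  - apply filter_forall. intros z t _. exists (pds u z t). apply H2.
  - intros t _. exact (smooth2_cont (pds u) s t H1).
  - apply filter_forall. intros z. apply ex_RInt_cont.
    intros y. now apply smooth2_continuous.
Qed.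

(* The [x]-derivative of [prim (u s)] is [u s], hence bounded near [(s, x)]; so
   continuity in [s] at fixed [x] upgrades to joint continuity. *)
Lemma continuity_2d_prim (u : R -> R -> R) (s x : R) :
  smooth2 u -> continuity_2d_pt (fun s x => prim (u s) x) s x.
Proof.
  intros Hu eps.
  pose proof (is_derive_continuity_pt _ _ _ (is_derive_prim_param u s x Hu))
    as Hc.
  assert (He : 0 < eps / 2) by (destruct eps; simpl; lra).
  destruct (Hc (eps / 2) He) as [d1 [Hd1 H1]].
  destruct (smooth2_cont u s x Hu (mkposreal 1 Rlt_0_1)) as [d2 H2].
  simpl in H2.
  set (M := Rabs (u s x) + 1).
  assert (HM : 0 < M) by (unfold M; pose proof (Rabs_pos (u s x)); lra).
  assert (Hq : 0 < eps / 2 / M) by (now apply Rdiv_lt_0_compat).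
  assert (Hd : 0 < Rmin d1 (Rmin d2 (eps / 2 / M))).
  { repeat apply Rmin_pos; auto. apply d2. }
  exists (mkposreal _ Hd). simpl. intros s' x' Hs' Hx'.
  assert (Rabs (prim (u s') x - prim (u s) x) < eps / 2).
  (* [continuity_pt] only speaks of points different from [s], so [s' = s] is a case of its own. *)
  { destruct (Req_dec s' s) as [->|Hn].
    - rewrite Rminus_diag, Rabs_R0. exact He.
    - apply H1. split.
      + split; [exact I|auto].
      + apply Rlt_le_trans with (1 := Hs'), Rmin_l. }
  assert (Hb : Rabs (prim (u s') x' - prim (u s') x) < eps / 2).
  { destruct (MVT_gen (prim (u s')) x x' (u s')) as [c [Hc1 Hc2]].
    - intros; apply is_derive_prim; intros; now apply smooth2_continuous.
    - intros. eapply is_derive_continuity_pt, is_derive_prim.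
      intros; now apply smooth2_continuous.
    - rewrite Hc2, Rabs_mult.
      assert (Hcx : Rabs (c - x) <= Rabs (x' - x)).
      { revert Hc1. unfold Rmin, Rmax, Rabs.
        destruct (Rle_dec x x'), (Rcase_abs (c - x)), (Rcase_abs (x' - x)); lra. }
      assert (Hu1 : Rabs (u s' c - u s x) < 1).
      { apply H2.
        - apply Rlt_le_trans with (1 := Hs').
          eapply Rle_trans; [apply Rmin_r|apply Rmin_l].
        - apply Rle_lt_trans with (1 := Hcx).
          apply Rlt_le_trans with (1 := Hx').
          eapply Rle_trans; [apply Rmin_r|apply Rmin_l]. }
      assert (Rabs (u s' c) < M).
      { unfold M. pose proof (Rabs_triang_inv (u s' c) (u s x)). lra. }
      assert (Rabs (x' - x) < eps / 2 / M).
      { apply Rlt_le_trans with (1 := Hx').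
        eapply Rle_trans; [apply Rmin_r|apply Rmin_r]. }
      replace (eps / 2) with (M * (eps / 2 / M)) by (field; lra).
      apply Rmult_le_0_lt_compat; auto using Rabs_pos. }
  replace (prim (u s') x' - prim (u s) x) with
    ((prim (u s') x' - prim (u s') x) + (prim (u s') x - prim (u s) x)) by ring.
  apply Rle_lt_trans with (1 := Rabs_triang _ _). lra.
Qed.

(** Differentiating [prim (w s) x] in [s] gives another primitive, but differentiating in [x] gives
    [w] itself; hence the invariant class contains the smooth functions as well as their
    primitives. *)
Lemma smooth2_prim (u : R -> R -> R) :
  smooth2 u -> smooth2 (fun s x => prim (u s) x).
Proof.
  intros Hu.
  apply (smooth2_coind (fun v => smooth2 v \/
    exists w, smooth2 w /\ v = fun s x => prim (w s) x));
    [|right; now exists u].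
  intros v [Hv|[w [Hw ->]]].
  - destruct (smooth2_pds v Hv), (smooth2_pdx v Hv). repeat split.
    + intros; now apply smooth2_cont.
    + exists (pds v); auto.
    + exists (pdx v); auto.
  - destruct (smooth2_pds w Hw) as [H1 H2]. repeat split.
    + intros; now apply continuity_2d_prim.
    + exists (fun s x => prim (pds w s) x). split; [right; now exists (pds w)|].
      intros; now apply is_derive_prim_param.
    + exists w. split; [now left|].
      intros; apply is_derive_prim; intros; now apply smooth2_continuous.
Qed.

(** This and the one-variable rules that follow are the [s]-independent instances of those for
    [smooth2]. *)
Lemma smooth_const (k : R) : smooth (fun _ => k).
Proof. exact (smooth2_smooth _ 0 (smooth2_const k)). Qed.

Lemma smooth_plus (f g : R -> R) :
  smooth f -> smooth g -> smooth (fun x => f x + g x).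
Proof.
  intros Hf Hg. exact (smooth2_smooth _ 0
    (smooth2_plus _ _ (smooth_smooth2 f Hf) (smooth_smooth2 g Hg))).
Qed.

Lemma smooth_mult (f g : R -> R) :
  smooth f -> smooth g -> smooth (fun x => f x * g x).
Proof.
  intros Hf Hg. exact (smooth2_smooth _ 0
    (smooth2_mult _ _ (smooth_smooth2 f Hf) (smooth_smooth2 g Hg))).
Qed.

Lemma smooth_minus (f g : R -> R) :
  smooth f -> smooth g -> smooth (fun x => f x - g x).
Proof.
  intros Hf Hg. exact (smooth2_smooth _ 0
    (smooth2_minus _ _ (smooth_smooth2 f Hf) (smooth_smooth2 g Hg))).
Qed.

Lemma smooth_div (f g : R -> R) : (forall x, g x <> 0) ->
  smooth f -> smooth g -> smooth (fun x => f x / g x).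
Proof.
  intros H Hf Hg. exact (smooth2_smooth _ 0
    (smooth2_div _ _ (fun _ => H) (smooth_smooth2 f Hf) (smooth_smooth2 g Hg))).
Qed.

Lemma smooth_prim (f : R -> R) : smooth f -> smooth (prim f).
Proof.
  intros Hf. exact (smooth2_smooth _ 0 (smooth2_prim _ (smooth_smooth2 f Hf))).
Qed.

Lemma smooth_lincomb (a b : R) (f g : R -> R) :
  smooth f -> smooth g -> smooth (lincomb a f b g).
Proof.
  intros Hf Hg. apply (smooth_plus (fun x => a * f x) (fun x => b * g x));
    apply (smooth_mult (fun _ => _)); auto using smooth_const.
Qed.

(** * Primitives, inner products and polar forms *)

Lemma prim_unique (F f : R -> R) (x : R) :
  (forall y, continuous f y) -> (forall y, is_derive F y (f y)) ->
  prim f x = F x - F 0.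
Proof.
  intros Hc HF.
  pose proof (is_derive_0_const (fun y => prim f y + -1 * F y)) as H.
  assert (E : prim f x + -1 * F x = prim f 0 + -1 * F 0).
  { apply H. intros y.
    eapply is_derive_value.
    - apply is_derive_Rplus; [now apply is_derive_prim|].
      apply (is_derive_Rmult (fun _ => -1) F); [|apply HF].
      exact (is_derive_const (-1) y).
    - unfold zero; simpl. ring. }
  rewrite prim_0 in E. lra.
Qed.

Lemma prim_ext (f g : R -> R) (x : R) :
  (forall y, f y = g y) -> prim f x = prim g x.
Proof. intros H. apply RInt_ext. intros; apply H. Qed.

(** The integrand [h] is matched only pointwise, so each later use reduces to a [ring] identity;
    [b = 0] or [f = g] turns it into a scaling rule. *)
Lemma prim_lin (f g h : R -> R) (a b x : R) :
  (forall y, continuous f y) -> (forall y, continuous g y) ->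
  (forall y, h y = a * f y + b * g y) ->
  prim h x = a * prim f x + b * prim g x.
Proof.
  intros Hf Hg Hh.
  replace h with (fun y => a * f y + b * g y)
    by (apply functional_extensionality; intros; now rewrite Hh).
  rewrite (prim_unique (fun y => a * prim f y + b * prim g y)).
  - rewrite !prim_0. ring.
  - intros y. apply (continuous_plus (fun y => a * f y) (fun y => b * g y));
      [apply (continuous_mult (fun _ => a) f)
      |apply (continuous_mult (fun _ => b) g)]; auto using continuous_const.
  - intros y. apply (is_derive_Rplus (fun y => a * prim f y)
      (fun y => b * prim g y));
      apply is_derive_scal; now apply is_derive_prim.
Qed.

Lemma is_derive_shift (F : R -> R) (T x l : R) :
  is_derive F (x + T) l -> is_derive (fun y => F (y + T)) x l.
Proof.
  intros H. eapply is_derive_value.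
  - apply (is_derive_Rcomp F (fun y => y + T)); [exact H|].
    apply (is_derive_Rplus (fun y => y) (fun _ => T)).
    + exact (is_derive_id x).
    + exact (is_derive_const T x).
  - unfold one, zero; simpl. ring.
Qed.

Lemma prim_period (f : R -> R) (T x : R) :
  (forall y, continuous f y) -> (forall y, f (y + T) = f y) ->
  prim f (x + T) = prim f x + prim f T.
Proof.
  intros Hc HT.
  rewrite (prim_unique (fun y => prim f (y + T)) f x Hc).
  - rewrite Rplus_0_l. ring.
  - intros y. apply is_derive_shift. rewrite <- HT.
    now apply is_derive_prim.
Qed.

Lemma inner_prim (f g : R -> R) :
  inner f g = prim (fun x => f x * g x) (2 * PI).
Proof. reflexivity. Qed.

Lemma inner_sym (f g : R -> R) : inner f g = inner g f.
Proof. apply prim_ext. intros; ring. Qed.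

Lemma smooth_mult_continuous (f g : R -> R) (x : R) :
  smooth f -> smooth g -> continuous (fun x => f x * g x) x.
Proof. intros; now apply smooth_continuous, smooth_mult. Qed.

Lemma inner_lincomb_l (a b : R) (f g h : R -> R) :
  smooth f -> smooth g -> smooth h ->
  inner (lincomb a f b g) h = a * inner f h + b * inner g h.
Proof.
  intros Hf Hg Hh. rewrite !inner_prim. apply prim_lin;
    try (intros; now apply smooth_mult_continuous).
  intros; unfold lincomb; ring.
Qed.

Lemma inner_lincomb_r (a b : R) (f g h : R -> R) :
  smooth f -> smooth g -> smooth h ->
  inner h (lincomb a f b g) = a * inner h f + b * inner h g.
Proof.
  intros. rewrite inner_sym, inner_lincomb_l by assumption.
  now rewrite (inner_sym f), (inner_sym g).
Qed.

Lemma inV_sq_period (p : parity) (u v : R -> R) (x : R) :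
  inV p u -> inV p v -> u (x + 2 * PI) * v (x + 2 * PI) = u x * v x.
Proof. intros [_ Hu] [_ Hv]. rewrite Hu, Hv. destruct p; ring. Qed.

Lemma inV_lincomb (p : parity) (a b : R) (u v : R -> R) :
  inV p u -> inV p v -> inV p (lincomb a u b v).
Proof.
  intros [Su Hu] [Sv Hv]. split; [now apply smooth_lincomb|].
  intros x. unfold lincomb. rewrite Hu, Hv. destruct p; ring.
Qed.

Lemma inner_nonneg (u : R -> R) : smooth u -> 0 <= inner u u.
Proof.
  intros Hu. apply RInt_ge_0.
  - pose proof PI_RGT_0; lra.
  - apply ex_RInt_cont. intros; now apply smooth_mult_continuous.
  - intros. apply Rle_0_sqr.
Qed.

(* [F = prim (u ^ 2)] is nondecreasing with [F (x + 2 PI) = F x], hence constant. *)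
Lemma inner_definite (p : parity) (u : R -> R) :
  inV p u -> inner u u = 0 -> forall x, u x = 0.
Proof.
  intros Hu H0 x. pose proof PI_RGT_0 as Hpi.
  assert (Su : smooth u) by apply Hu.
  set (F := prim (fun y => u y * u y)).
  assert (Hc : forall y, continuous (fun y => u y * u y) y)
    by (intros; now apply smooth_mult_continuous).
  assert (HF : forall y, is_derive F y (u y * u y))
    by (intros; now apply (is_derive_prim (fun y => u y * u y))).
  assert (HP : forall y, F (y + 2 * PI) = F y).
  { intros y. unfold F. rewrite prim_period; auto.
    - rewrite <- inner_prim, H0. ring.
    - intros; now apply inV_sq_period with p. }
  assert (Hm : forall y z, y <= z -> F y <= F z).
  { intros y z Hyz. destruct (MVT_gen F y z (fun y => u y * u y)) as [c [_ E]].
    - intros; apply HF.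
    - intros; eapply is_derive_continuity_pt, HF.
    - assert (0 <= u c * u c * (z - y)).
      { apply Rmult_le_pos; [apply Rle_0_sqr|lra]. }
      lra. }
  (* The base point is arbitrary. For [y <= z], the value [F z] is squeezed between [F y] and
     [F (y + 2 n PI) = F y] for [n] large. *)
  assert (Hk : forall y, F y = F (x - PI)).
  { assert (K : forall n y z, y <= z <= y + IZR (Z.of_nat n) * (2 * PI) -> F z = F y).
    { intros n y z [h1 h2].
      assert (E : forall m, F (y + IZR (Z.of_nat m) * (2 * PI)) = F y).
      { induction m as [|m IH]; [now rewrite Rmult_0_l, Rplus_0_r|].
        rewrite Nat2Z.inj_succ, succ_IZR.
        replace (y + (IZR (Z.of_nat m) + 1) * (2 * PI)) with
          (y + IZR (Z.of_nat m) * (2 * PI) + 2 * PI) by ring.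
        now rewrite HP. }
      apply Rle_antisym; [rewrite <- (E n)|]; now apply Hm. }
    assert (K2 : forall y z, y <= z -> F z = F y).
    { intros y z h. destruct (nfloor_ex ((z - y) / (2 * PI))) as [n [_ Hn]].
      { apply Rcomplements.Rdiv_le_0_compat; lra. }
      apply (K (S n)). split; [exact h|].
      rewrite <- INR_IZR_INZ, S_INR.
      apply Rcomplements.Rlt_div_l in Hn; lra. }
    intros y. destruct (Rle_lt_dec y (x - PI)) as [h|h].
    - symmetry; now apply K2.
    - apply K2; lra. }
  assert (E : u x * u x = 0).
  { rewrite <- (is_derive_unique F x _ (HF x)).
    apply is_derive_unique.
    apply (is_derive_ext (fun _ => F (x - PI))).
    - intros; symmetry; apply Hk.
    - exact (is_derive_const (F (x - PI)) x). }
  now apply Rsqr_0_uniq.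
Qed.

Lemma unit_angle (x y : R) :
  x * x + y * y = 1 -> exists a, x = cos a /\ y = sin a.
Proof.
  intros H. assert (Hx : -1 <= x <= 1) by (split; nra).
  assert (Hs : sin (acos x) * sin (acos x) = y * y).
  { pose proof (sin2_cos2 (acos x)) as E. unfold Rsqr in E.
    rewrite cos_acos in E by exact Hx. lra. }
  assert (Hp : y = sin (acos x) \/ y = - sin (acos x)).
  { assert (E : (y - sin (acos x)) * (y + sin (acos x)) = 0) by lra.
    apply Rmult_integral in E. lra. }
  destruct Hp as [Hp|Hp].
  - exists (acos x). now rewrite cos_acos.
  - exists (- acos x). now rewrite cos_neg, sin_neg, cos_acos.
Qed.

Lemma sin_cos_int (k : Z) :
  sin (IZR k * PI) = 0 /\
  (Z.Even k -> cos (IZR k * PI) = 1) /\ (Z.Odd k -> cos (IZR k * PI) = -1).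
Proof.
  assert (S : forall m, sin (IZR m * PI) = 0)
    by (intros m; apply sin_eq_0_1; now exists m).
  assert (H : forall m, cos (IZR (2 * m) * PI) = 1).
  { intros m. rewrite mult_IZR, Rmult_assoc, cos_2a_sin, S. ring. }
  repeat split; auto.
  - intros [m ->]. apply H.
  - intros [m ->]. rewrite plus_IZR, Rmult_plus_distr_r, Rmult_1_l, neg_cos, H.
    reflexivity.
Qed.

Lemma is_derive_zero_ext (f : R -> R) (l : R -> R) :
  (forall x, is_derive f x (l x)) -> (forall x, l x = 0) ->
  forall x y, f x = f y.
Proof.
  intros H E. apply is_derive_0_const. intros x. rewrite <- (E x). apply H.
Qed.

(* The equation solved by [z = a + i b] is [z' = z (A + i B)']. *)
Lemma polar_form (a b A B a' b' A' B' : R -> R) :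
  (forall x, is_derive a x (a' x)) -> (forall x, is_derive b x (b' x)) ->
  (forall x, is_derive A x (A' x)) -> (forall x, is_derive B x (B' x)) ->
  (forall x, a' x = a x * A' x - b x * B' x) ->
  (forall x, b' x = b x * A' x + a x * B' x) ->
  A 0 = 0 -> B 0 = 0 ->
  forall x, a x = exp (A x) * (a 0 * cos (B x) - b 0 * sin (B x)) /\
            b x = exp (A x) * (a 0 * sin (B x) + b 0 * cos (B x)).
Proof.
  intros Ha Hb HA HB Ea Eb A0 B0 x.
  assert (D : forall y, ex_derive a y /\ ex_derive b y /\ ex_derive A y /\
    ex_derive B y).
  { intros y. repeat split; eexists; eauto. }
  assert (V : forall y, Derive a y = a' y /\ Derive b y = b' y /\
    Derive A y = A' y /\ Derive B y = B' y).
  { intros y. repeat split; apply is_derive_unique; auto. }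
  (* [E1] and [E2] are the real and imaginary parts of the assertion that [z exp (- (A + i B))] is
     constant. *)
  assert (E1 : exp (- A x) * (a x * cos (B x) + b x * sin (B x)) =
    exp (- A 0) * (a 0 * cos (B 0) + b 0 * sin (B 0))).
  { pattern x, 0.
    apply (is_derive_zero_ext
      (fun y => exp (- A y) * (a y * cos (B y) + b y * sin (B y)))
      (fun y => exp (- A y) * (- A' y * (a y * cos (B y) + b y * sin (B y))
        + a' y * cos (B y) - a y * B' y * sin (B y) + b' y * sin (B y)
        + b y * B' y * cos (B y)))).
    - intros y. destruct (D y) as [? [? [? ?]]], (V y) as [V1 [V2 [V3 V4]]].
      auto_derive; [now repeat split|].
      change (fun x : R => a x) with a. change (fun x : R => b x) with b.
      change (fun x : R => A x) with A. change (fun x : R => B x) with B.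
      rewrite V1, V2, V3, V4. ring.
    - intros y. rewrite Ea, Eb. ring. }
  assert (E2 : exp (- A x) * (b x * cos (B x) - a x * sin (B x)) =
    exp (- A 0) * (b 0 * cos (B 0) - a 0 * sin (B 0))).
  { pattern x, 0.
    apply (is_derive_zero_ext
      (fun y => exp (- A y) * (b y * cos (B y) - a y * sin (B y)))
      (fun y => exp (- A y) * (- A' y * (b y * cos (B y) - a y * sin (B y))
        + b' y * cos (B y) - b y * B' y * sin (B y) - a' y * sin (B y)
        - a y * B' y * cos (B y)))).
    - intros y. destruct (D y) as [? [? [? ?]]], (V y) as [V1 [V2 [V3 V4]]].
      auto_derive; [now repeat split|].
      change (fun x : R => a x) with a. change (fun x : R => b x) with b.
      change (fun x : R => A x) with A. change (fun x : R => B x) with B.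
      rewrite V1, V2, V3, V4. ring.
    - intros y. rewrite Ea, Eb. ring. }
  rewrite A0, B0, Ropp_0, exp_0, cos_0, sin_0 in E1, E2.
  assert (X : exp (A x) * exp (- A x) = 1).
  { rewrite <- exp_plus, Rplus_opp_r. apply exp_0. }
  assert (T : cos (B x) * cos (B x) + sin (B x) * sin (B x) = 1).
  { pose proof (sin2_cos2 (B x)) as E. unfold Rsqr in E. lra. }
  assert (F1 : a 0 = exp (- A x) * (a x * cos (B x) + b x * sin (B x))) by lra.
  assert (F2 : b 0 = exp (- A x) * (b x * cos (B x) - a x * sin (B x))) by lra.
  split.
  - rewrite F1, F2.
    transitivity ((exp (A x) * exp (- A x)) * a x *
      (cos (B x) * cos (B x) + sin (B x) * sin (B x))); [|ring].
    rewrite X, T. ring.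
  - rewrite F1, F2.
    transitivity ((exp (A x) * exp (- A x)) * b x *
      (cos (B x) * cos (B x) + sin (B x) * sin (B x))); [|ring].
    rewrite X, T. ring.
Qed.

(* The real and imaginary parts of [z' / z] for [z = a + i b]. *)
Definition logd (a b : R -> R) : R -> R := fun x =>
  (a x * Derive a x + b x * Derive b x) / (a x * a x + b x * b x).
Definition argd (a b : R -> R) : R -> R := fun x =>
  (a x * Derive b x - b x * Derive a x) / (a x * a x + b x * b x).

Lemma smooth_logd (a b : R -> R) : smooth a -> smooth b ->
  (forall x, a x * a x + b x * b x <> 0) -> smooth (logd a b).
Proof.
  intros Ha Hb Hn. destruct (smooth_Derive a Ha), (smooth_Derive b Hb).
  apply smooth_div; [exact Hn| |];
    apply smooth_plus; now apply smooth_mult.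
Qed.

Lemma smooth_argd (a b : R -> R) : smooth a -> smooth b ->
  (forall x, a x * a x + b x * b x <> 0) -> smooth (argd a b).
Proof.
  intros Ha Hb Hn. destruct (smooth_Derive a Ha), (smooth_Derive b Hb).
  apply smooth_div; [exact Hn| |].
  - apply smooth_minus; now apply smooth_mult.
  - apply smooth_plus; now apply smooth_mult.
Qed.

(** Integrating [z' / z] gives a logarithm of [z / z 0] on the whole line, without any branch of the
    argument. *)
Lemma polar_lift (a b : R -> R) : smooth a -> smooth b ->
  (forall x, a x * a x + b x * b x <> 0) ->
  forall x, a x = exp (prim (logd a b) x) *
      (a 0 * cos (prim (argd a b) x) - b 0 * sin (prim (argd a b) x)) /\
    b x = exp (prim (logd a b) x) *
      (a 0 * sin (prim (argd a b) x) + b 0 * cos (prim (argd a b) x)).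
Proof.
  intros Ha Hb Hn.
  apply (polar_form a b _ _ (Derive a) (Derive b) (logd a b) (argd a b)).
  - now apply smooth_Derive.
  - now apply smooth_Derive.
  - intros; apply is_derive_prim; intros; now apply smooth_continuous, smooth_logd.
  - intros; apply is_derive_prim; intros; now apply smooth_continuous, smooth_argd.
  - intros x; unfold logd, argd; field; apply Hn.
  - intros x; unfold logd, argd; field; apply Hn.
  - apply prim_0.
  - apply prim_0.
Qed.

Lemma sum_sqr_0 (x y : R) : x * x + y * y = 0 -> x = 0 /\ y = 0.
Proof. intros H; split; nra. Qed.

(** With [wk = ek + i fk], the product of [|w2 - w1|^2] and [|w2 + w1|^2] is [|w2^2 - w1^2|^2], so
    one of the factors vanishes. The coefficient 4 in the proof comes from [Im (w^2) = 2 e f]. *)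
Lemma sqrt_sign_pt (e1 f1 e2 f2 : R) :
  e1 * e1 - f1 * f1 = e2 * e2 - f2 * f2 -> e1 * f1 = e2 * f2 ->
  (e2 = e1 /\ f2 = f1) \/ (e2 = - e1 /\ f2 = - f1).
Proof.
  intros H1 H2.
  assert (E : ((e2 - e1) * (e2 - e1) + (f2 - f1) * (f2 - f1)) *
    ((e2 + e1) * (e2 + e1) + (f2 + f1) * (f2 + f1)) = 0).
  { transitivity (Rsqr (e2 * e2 - f2 * f2 - (e1 * e1 - f1 * f1)) +
      4 * Rsqr (e2 * f2 - e1 * f1)); [unfold Rsqr; ring|].
    rewrite H1, H2, !Rminus_diag. unfold Rsqr; ring. }
  apply Rmult_integral in E. destruct E as [E|E];
    apply sum_sqr_0 in E; [left|right]; lra.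
Qed.

(* [Re (w2 / w1)] has square 1, hence zero derivative. *)
Lemma sqrt_sign (e1 f1 e2 f2 : R -> R) :
  smooth e1 -> smooth f1 -> smooth e2 -> smooth f2 ->
  (forall x, e1 x * e1 x + f1 x * f1 x <> 0) ->
  (forall x, e1 x * e1 x - f1 x * f1 x = e2 x * e2 x - f2 x * f2 x) ->
  (forall x, e1 x * f1 x = e2 x * f2 x) ->
  exists t, (t = 1 \/ t = -1) /\ forall x, e2 x = t * e1 x /\ f2 x = t * f1 x.
Proof.
  intros S1 S2 S3 S4 Hn H1 H2.
  set (t := fun x => (e1 x * e2 x + f1 x * f2 x) / (e1 x * e1 x + f1 x * f1 x)).
  assert (St : smooth t).
  { apply smooth_div; [exact Hn| |]; apply smooth_plus; now apply smooth_mult. }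
  assert (P : forall x, (t x = 1 \/ t x = -1) /\
    e2 x = t x * e1 x /\ f2 x = t x * f1 x).
  { intros x. unfold t.
    destruct (sqrt_sign_pt (e1 x) (f1 x) (e2 x) (f2 x)) as [[-> ->]|[-> ->]]; auto.
    - replace ((e1 x * e1 x + f1 x * f1 x) / (e1 x * e1 x + f1 x * f1 x))
        with 1 by (field; apply Hn). lra.
    - replace ((e1 x * - e1 x + f1 x * - f1 x) / (e1 x * e1 x + f1 x * f1 x))
        with (-1) by (field; apply Hn). lra. }
  destruct (smooth_Derive t St) as [_ Dt].
  assert (Z : forall x, Derive t x = 0).
  { intros x.
    assert (E : 2 * t x * Derive t x = 0).
    { transitivity (Derive (fun y => t y * t y) x).
      - symmetry. apply is_derive_unique. eapply is_derive_value.
        + apply is_derive_Rmult; apply Dt.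
        + ring.
      - apply is_derive_unique. apply (is_derive_ext (fun _ => 1)).
        + intros y. change (1 = t y * t y).
          destruct (P y) as [[-> | ->] _]; ring.
        + exact (is_derive_const 1 x). }
    destruct (P x) as [[Hx|Hx] _]; rewrite Hx in E; lra. }
  exists (t 0). split; [apply P|]. intros x.
  rewrite (is_derive_zero_ext t _ Dt Z 0 x). apply P.
Qed.

(** * Planes and their orthonormal frames *)

(** The clauses of [is_plane] with their witnesses exposed, so that the basis can be changed. *)
Definition basis (r : bool) (p : parity) (W : plane) (e f : R -> R) : Prop :=
  inV p e /\ inV p f /\
  (forall a b, (forall x, lincomb a e b f x = 0) -> a = 0 /\ b = 0) /\
  (forall u, carrier W u <-> exists a b, u = lincomb a e b f) /\
  (forall u v, frames W u v <-> exists a b a' b',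
     u = lincomb a e b f /\ v = lincomb a' e b' f /\
     admissible_det r (a * b' - b * a')).

Definition span_plane (r : bool) (e f : R -> R) : plane :=
  Plane (fun u => exists a b, u = lincomb a e b f)
    (fun u v => exists a b a' b',
       u = lincomb a e b f /\ v = lincomb a' e b' f /\
       admissible_det r (a * b' - b * a')).

Lemma lincomb_lincomb (a b c d c' d' : R) (e f : R -> R) :
  lincomb a (lincomb c e d f) b (lincomb c' e d' f) =
  lincomb (a * c + b * c') e (a * d + b * d') f.
Proof. apply functional_extensionality; intros; unfold lincomb; ring. Qed.

Lemma lincomb_10 (e f : R -> R) : lincomb 1 e 0 f = e.
Proof. apply functional_extensionality; intros; unfold lincomb; ring. Qed.

Lemma lincomb_01 (e f : R -> R) : lincomb 0 e 1 f = f.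
Proof. apply functional_extensionality; intros; unfold lincomb; ring. Qed.

Lemma admissible_det_1 (r : bool) : admissible_det r 1.
Proof. destruct r; simpl; lra. Qed.

Lemma admissible_det_neq (r : bool) (d : R) : admissible_det r d -> d <> 0.
Proof. destruct r; simpl; lra. Qed.

Lemma admissible_det_mult (r : bool) (d d' : R) :
  admissible_det r d -> admissible_det r d' -> admissible_det r (d * d').
Proof.
  destruct r; simpl; intros H H'.
  - now apply Rmult_integral_contrapositive.
  - now apply Rmult_lt_0_compat.
Qed.

Lemma admissible_det_inv (r : bool) (d : R) :
  admissible_det r d -> admissible_det r (/ d).
Proof.
  destruct r; simpl; intros H.
  - now apply Rinv_neq_0_compat.
  - now apply Rinv_0_lt_compat.
Qed.

Lemma basis_frames (r : bool) (p : parity) (W : plane) (e f : R -> R) :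
  basis r p W e f -> frames W e f.
Proof.
  intros (_ & _ & _ & _ & H). apply H. exists 1, 0, 0, 1.
  rewrite lincomb_10, lincomb_01. repeat split.
  replace (1 * 1 - 0 * 0) with 1 by ring. apply admissible_det_1.
Qed.

(** Admissible determinants are closed under products and inverses, so every frame generates the
    same plane and the same set of frames as the defining basis. *)
Lemma basis_change (r : bool) (p : parity) (W : plane) (e0 f0 e f : R -> R) :
  basis r p W e0 f0 -> frames W e f -> basis r p W e f.
Proof.
  intros (He & Hf & Hi & Hc & Hfr) H.
  apply Hfr in H. destruct H as (a & b & a' & b' & -> & -> & Hd).
  pose proof (admissible_det_neq _ _ Hd) as Hd0.
  set (d := a * b' - b * a') in *.
  (* Cramer's rule for the change of basis, whose inverse has determinant [/ d]. *)
  assert (Inv : forall k l, lincomb k e0 l f0 =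
    lincomb ((k * b' - l * a') / d) (lincomb a e0 b f0)
      ((l * a - k * b) / d) (lincomb a' e0 b' f0)).
  { intros k l. rewrite lincomb_lincomb. 
    f_equal; unfold d in *; field; exact Hd0. }
  split; [now apply inV_lincomb|]. split; [now apply inV_lincomb|].
  split; [|split].
  - intros k l Hkl.
    destruct (Hi (k * a + l * a') (k * b + l * b')) as [E1 E2].
    { intros x. rewrite <- lincomb_lincomb. apply Hkl. }
    split; apply Rmult_eq_reg_r with d; auto; rewrite Rmult_0_l; unfold d.
    + transitivity (b' * (k * a + l * a') - a' * (k * b + l * b')); [ring|].
      rewrite E1, E2; ring.
    + transitivity (a * (k * b + l * b') - b * (k * a + l * a')); [ring|].
      rewrite E1, E2; ring.
  - intros u. rewrite Hc. split; intros (k & l & ->).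
    + do 2 eexists. apply Inv.
    + rewrite lincomb_lincomb. now do 2 eexists.
  - intros u v. rewrite Hfr. split.
    + intros (k & l & k' & l' & -> & -> & D).
      do 4 eexists. split; [apply Inv|]. split; [apply Inv|].
      match goal with |- admissible_det r ?t =>
        replace t with ((k * l' - l * k') * / d) end.
      * apply admissible_det_mult; auto using admissible_det_inv.
      * unfold d in *. field. exact Hd0.
    + intros (k & l & k' & l' & -> & -> & D). rewrite !lincomb_lincomb.
      do 4 eexists. split; [reflexivity|]. split; [reflexivity|].
      match goal with |- admissible_det r ?t =>
        replace t with ((k * l' - l * k') * d) by (unfold d; ring) end.
      now apply admissible_det_mult.
Qed.

Lemma plane_basis (r : bool) (p : parity) (W : plane) (e f : R -> R) :
  is_plane r p W -> frames W e f -> basis r p W e f.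
Proof. intros (e0 & f0 & H0). now apply (basis_change r p W e0 f0). Qed.

Lemma basis_plane_eq (r : bool) (p : parity) (W W' : plane) (e f : R -> R) :
  basis r p W e f -> basis r p W' e f -> W = W'.
Proof.
  intros (_ & _ & _ & Hc & Hf) (_ & _ & _ & Hc' & Hf').
  destruct W as [c fr], W' as [c' fr']. simpl in *. f_equal.
  - apply functional_extensionality; intros u.
    apply propositional_extensionality. now rewrite Hc, Hc'.
  - do 2 (apply functional_extensionality; intros ?).
    apply propositional_extensionality. now rewrite Hf, Hf'.
Qed.

Lemma orthonormal_independent (p : parity) (e f : R -> R) :
  inV p e -> inV p f -> orthonormal e f ->
  forall a b, (forall x, lincomb a e b f x = 0) -> a = 0 /\ b = 0.
Proof.
  intros [He _] [Hf _] (H1 & H2 & H3) a b H.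
  assert (E : forall u, inner (lincomb a e b f) u = 0).
  { intros u. rewrite inner_prim.
    rewrite (prim_ext _ (fun _ => 0)) by (intros y; rewrite H; ring).
    unfold prim. rewrite (RInt_const 0 (2 * PI) (0 : R)).
    unfold scal; simpl; unfold mult; simpl; ring. }
  pose proof (E e) as Ee. pose proof (E f) as Ef.
  rewrite inner_lincomb_l in Ee, Ef by assumption.
  rewrite (inner_sym f e) in Ee. rewrite H1, H3 in Ee. rewrite H2, H3 in Ef. lra.
Qed.

Lemma span_plane_basis (r : bool) (p : parity) (e f : R -> R) :
  inV p e -> inV p f -> orthonormal e f -> basis r p (span_plane r e f) e f.
Proof.
  intros He Hf Ho. split; [exact He|]. split; [exact Hf|].
  split; [now apply orthonormal_independent with p|]. split; reflexivity.
Qed.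

Lemma basis_nonzero (r : bool) (p : parity) (W : plane) (e f : R -> R) :
  basis r p W e f ->
  (no_common_zero W <-> forall x, e x * e x + f x * f x <> 0).
Proof.
  intros (_ & _ & _ & Hc & _). split.
  - intros H x E. apply sum_sqr_0 in E. destruct E as [E1 E2].
    apply H. exists x. intros u Hu. apply Hc in Hu.
    destruct Hu as (a & b & ->). unfold lincomb. rewrite E1, E2. ring.
  - intros H [x Hx]. apply (H x).
    rewrite (Hx e), (Hx f); [ring| |]; apply Hc.
    + exists 0, 1. now rewrite lincomb_01.
    + exists 1, 0. now rewrite lincomb_10.
Qed.

Lemma inner_pos (p : parity) (u : R -> R) :
  inV p u -> (exists x, u x <> 0) -> 0 < inner u u.
Proof.
  intros Hu [x Hx]. destruct (inner_nonneg u (proj1 Hu)) as [H|H]; [exact H|].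
  destruct Hx. now apply (inner_definite p u Hu).
Qed.

Lemma not_all_zero (u : R -> R) : (~ forall x, u x = 0) -> exists x, u x <> 0.
Proof.
  intros H. destruct (Classical_Prop.classic (exists x, u x <> 0)) as [E|E]; auto.
  destruct H. intros x. destruct (Req_dec (u x) 0); auto. destruct E. now exists x.
Qed.

(** Gram-Schmidt. Both normalizing factors are positive, so the change has determinant
    [/ n * / m > 0] and respects an orientation. *)
Lemma orthonormal_frame_exists (r : bool) (p : parity) (W : plane) :
  is_plane r p W -> exists e f, orthonormal_frame W e f.
Proof.
  intros (e0 & f0 & He & Hf & Hi & Hc & Hfr).
  assert (P1 : 0 < inner e0 e0).
  { apply inner_pos with p; auto. apply not_all_zero. intros Z.
    destruct (Hi 1 0) as [E _]; [|lra].
    intros x. rewrite lincomb_10. apply Z. }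
  set (n := sqrt (inner e0 e0)).
  assert (Hn : 0 < n) by now apply sqrt_lt_R0.
  assert (Nn : n * n = inner e0 e0) by (apply sqrt_sqrt; lra).
  set (k := inner f0 e0 / inner e0 e0).
  set (g := lincomb (- k) e0 1 f0).
  assert (Hg : inV p g) by now apply inV_lincomb.
  assert (P2 : 0 < inner g g).
  { apply inner_pos with p; auto. apply not_all_zero. intros Z.
    destruct (Hi (- k) 1 Z) as [_ E]. lra. }
  set (m := sqrt (inner g g)).
  assert (Hm : 0 < m) by now apply sqrt_lt_R0.
  assert (Nm : m * m = inner g g) by (apply sqrt_sqrt; lra).
  assert (Hge : inner e0 g = 0).
  { unfold g. rewrite inner_lincomb_r by (apply He || apply Hf).
    rewrite (inner_sym e0 f0). unfold k. field. lra. }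
  exists (lincomb (/ n) e0 0 f0), (lincomb 0 e0 (/ m) g).
  assert (Se : smooth e0) by apply He. assert (Sf : smooth f0) by apply Hf.
  assert (Sg : smooth g) by apply Hg.
  split.
  - apply Hfr. exists (/ n), 0, (/ m * - k), (/ m). split; [reflexivity|].
    split.
    + apply functional_extensionality; intros; unfold g, lincomb; ring.
    + replace (/ n * / m - 0 * (/ m * - k)) with (/ n * / m) by ring.
      apply admissible_det_mult; apply admissible_det_inv;
        destruct r; simpl; lra.
  - assert (S1 : smooth (lincomb (/ n) e0 0 f0)) by now apply smooth_lincomb.
    assert (S2 : smooth (lincomb 0 e0 (/ m) g)) by now apply smooth_lincomb.
    repeat split;
      rewrite inner_lincomb_l by assumption;
      rewrite !inner_lincomb_r by assumption;
      rewrite ?(inner_sym g e0), ?Hge, <- ?Nn, <- ?Nm; field; lra.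
Qed.

(* [turn1 + i turn2 = exp (i phi) (e + i f)] for [sigma = 1], and
   [exp (i phi) (e - i f)] for [sigma = -1]. *)
Definition turn1 (phi sigma : R) (e f : R -> R) : R -> R :=
  lincomb (cos phi) e (- (sigma * sin phi)) f.
Definition turn2 (phi sigma : R) (e f : R -> R) : R -> R :=
  lincomb (sin phi) e (sigma * cos phi) f.

(** The possible determinants of an orthogonal change of frame: -1 occurs only for unoriented
    planes. *)
Definition sign_ok (r : bool) (sigma : R) : Prop :=
  sigma = 1 \/ (r = true /\ sigma = -1).

Lemma sign_ok_sqr (r : bool) (s : R) : sign_ok r s -> s * s = 1.
Proof. intros [-> | [_ ->]]; ring. Qed.

Lemma turn_inner (phi sigma : R) (e f : R -> R) :
  sigma * sigma = 1 -> smooth e -> smooth f ->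
  inner e f = 0 -> inner e e = inner f f ->
  inner (turn1 phi sigma e f) (turn1 phi sigma e f) = inner e e /\
  inner (turn2 phi sigma e f) (turn2 phi sigma e f) = inner f f /\
  inner (turn1 phi sigma e f) (turn2 phi sigma e f) = 0.
Proof.
  intros Hs He Hf H0 H1.
  assert (T : sin phi * sin phi + cos phi * cos phi = 1)
    by exact (sin2_cos2 phi).
  assert (S1 : smooth (turn1 phi sigma e f)) by now apply smooth_lincomb.
  assert (S2 : smooth (turn2 phi sigma e f)) by now apply smooth_lincomb.
  unfold turn1, turn2 in *.
  repeat split; rewrite inner_lincomb_l by assumption;
    rewrite !inner_lincomb_r by assumption;
    rewrite ?(inner_sym f e), H0, <- ?H1.
  - transitivity ((cos phi * cos phi + (sigma * sigma) * (sin phi * sin phi))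
      * inner e e);
      [ring|].
    rewrite Hs, Rmult_1_l. replace (_ + _) with 1 by lra. ring.
  - transitivity ((sin phi * sin phi + (sigma * sigma) * (cos phi * cos phi))
      * inner e e);
      [ring|].
    rewrite Hs, Rmult_1_l. replace (_ + _) with 1 by lra. ring.
  - transitivity ((1 - sigma * sigma) * (cos phi * sin phi) * inner e e); [ring|].
    rewrite Hs. ring.
Qed.

Lemma turn_orthonormal_frame (r : bool) (p : parity) (W : plane)
    (phi sigma : R) (e f : R -> R) :
  is_plane r p W -> sign_ok r sigma -> orthonormal_frame W e f ->
  orthonormal_frame W (turn1 phi sigma e f) (turn2 phi sigma e f).
Proof.
  intros HW Hs [Hfr (H1 & H2 & H3)].
  destruct (plane_basis r p W e f HW Hfr) as (He & Hf & _ & _ & Hb).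
  assert (T : sin phi * sin phi + cos phi * cos phi = 1)
    by exact (sin2_cos2 phi).
  split.
  - apply Hb. do 4 eexists. split; [reflexivity|]. split; [reflexivity|].
    replace (_ - _) with sigma.
    + destruct Hs as [-> | [-> ->]]; [apply admissible_det_1|simpl; lra].
    + transitivity (sigma * (sin phi * sin phi + cos phi * cos phi)); [|ring].
      rewrite T. ring.
  - destruct (turn_inner phi sigma e f) as (E1 & E2 & E3);
      try (apply He || apply Hf || lra); [now apply sign_ok_sqr with r|].
    unfold orthonormal. lra.
Qed.

(** The matrix of the change is in O(2): it is determined by its determinant, which becomes [sigma],
    and by its first column [(a, a')], a point of the unit circle. *)
Lemma orthonormal_turn (r : bool) (e f : R -> R) (a b a' b' : R) :
  smooth e -> smooth f -> orthonormal e f ->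
  orthonormal (lincomb a e b f) (lincomb a' e b' f) ->
  (r = false -> 0 < a * b' - b * a') ->
  exists phi sigma, sign_ok r sigma /\
    lincomb a e b f = turn1 phi sigma e f /\
    lincomb a' e b' f = turn2 phi sigma e f.
Proof.
  intros He Hf (H1 & H2 & H3) (K1 & K2 & K3) Hd.
  assert (S1 : smooth (lincomb a e b f)) by now apply smooth_lincomb.
  assert (S2 : smooth (lincomb a' e b' f)) by now apply smooth_lincomb.
  rewrite inner_lincomb_l, !inner_lincomb_r, (inner_sym f e), H1, H2, H3
    in K1, K2, K3 by assumption.
  set (d := a * b' - b * a') in *.
  (* The squared determinant is the Gram determinant of the rows. *)
  assert (D2 : d * d = 1).
  { transitivity ((a * a + b * b) * (a' * a' + b' * b') -
      (a * a' + b * b') * (a * a' + b * b')); [unfold d; ring|].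
    replace (a * a + b * b) with 1 by lra.
    replace (a' * a' + b' * b') with 1 by lra.
    replace (a * a' + b * b') with 0 by lra. ring. }
  assert (Eb' : b' = d * a).
  { transitivity ((a * a + b * b) * b').
    - replace (a * a + b * b) with 1 by lra. ring.
    - unfold d. transitivity (a * a * b' - a * b * a' + b * (a * a' + b * b')); [ring|].
      replace (a * a' + b * b') with 0 by lra. ring. }
  assert (Eb : b = - (d * a')).
  { transitivity ((a' * a' + b' * b') * b).
    - replace (a' * a' + b' * b') with 1 by lra. ring.
    - unfold d. transitivity (b' * (a * a' + b * b') - (a * b' - b * a') * a'); [ring|].
      replace (a * a' + b * b') with 0 by lra. ring. }
  destruct (unit_angle a a') as (phi & Ea & Ea').
  { transitivity (a * a + (d * d) * (a' * a')); [rewrite D2; ring|].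
    transitivity (a * a + b * b); [rewrite Eb; ring|lra]. }
  exists phi, d. unfold turn1, turn2. rewrite <- Ea, <- Ea', <- Eb, <- Eb'.
  split; [|split; reflexivity].
  assert (Hd1 : d = 1 \/ d = -1).
  { assert (E : (d - 1) * (d + 1) = 0) by lra.
    apply Rmult_integral in E. lra. }
  destruct Hd1 as [Hd1|Hd1]; [now left|].
  destruct r; [now right|]. specialize (Hd eq_refl). lra.
Qed.

Lemma orthonormal_frame_turn (r : bool) (p : parity) (W : plane)
    (e f e' f' : R -> R) :
  is_plane r p W -> orthonormal_frame W e f -> orthonormal_frame W e' f' ->
  exists phi sigma, sign_ok r sigma /\
    e' = turn1 phi sigma e f /\ f' = turn2 phi sigma e f.
Proof.
  intros HW [Hfr Ho] [Hfr' Ho'].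
  destruct (plane_basis r p W e f HW Hfr) as (He & Hf & _ & _ & Hb).
  apply Hb in Hfr'. destruct Hfr' as (a & b & a' & b' & -> & -> & Hd).
  apply orthonormal_turn; auto; [apply He|apply Hf|intros ->; exact Hd].
Qed.

(** Behind the independence of [hom_normsq] from the orthonormal basis: [u] and [v] will be the
    images of such a basis under a linear map. *)
Lemma turn_inner_sum (phi sigma : R) (u v : R -> R) :
  sigma * sigma = 1 -> smooth u -> smooth v ->
  inner (turn1 phi sigma u v) (turn1 phi sigma u v) +
  inner (turn2 phi sigma u v) (turn2 phi sigma u v) = inner u u + inner v v.
Proof.
  intros Hs Hu Hv.
  assert (T : sin phi * sin phi + cos phi * cos phi = 1)
    by exact (sin2_cos2 phi).
  assert (S1 : smooth (turn1 phi sigma u v)) by now apply smooth_lincomb.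
  assert (S2 : smooth (turn2 phi sigma u v)) by now apply smooth_lincomb.
  unfold turn1, turn2 in *.
  rewrite !(inner_lincomb_l _ _ u v) by assumption.
  rewrite !inner_lincomb_r by assumption.
  rewrite (inner_sym v u).
  transitivity ((sin phi * sin phi + cos phi * cos phi) *
    (inner u u + (sigma * sigma) * inner v v)).
  - ring.
  - rewrite T, Hs. ring.
Qed.

(** * Curves as integrals of products *)

(* The curve [h] with [h 0 = 0] and [h' = (e + i f) (u + i v)]. *)
Definition wint (e f u v : R -> R) : R -> C := fun x =>
  (prim (fun y => e y * u y - f y * v y) x,
   prim (fun y => e y * v y + f y * u y) x).

(** Since [c' = w (w / 2)], the basic curve is [wint] with second factor [half e], [half f]; curves
    and their variations then share one form. *)
Definition half (f : R -> R) : R -> R := fun x => / 2 * f x.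

Lemma smooth_half (f : R -> R) : smooth f -> smooth (half f).
Proof. intros H. apply (smooth_mult (fun _ => / 2) f); auto using smooth_const. Qed.

Lemma inner_half (f g : R -> R) : smooth f -> smooth g ->
  inner f (half g) = / 2 * inner f g.
Proof.
  intros Hf Hg. replace (half g) with (lincomb (/ 2) g 0 g).
  - rewrite inner_lincomb_r by assumption. ring.
  - apply functional_extensionality; intros; unfold lincomb, half; ring.
Qed.

Ltac smooth_tac := try assumption; lazymatch goal with
  | |- smooth (fun _ => _ + _) => apply smooth_plus; smooth_tac
  | |- smooth (fun _ => _ - _) => apply smooth_minus; smooth_tac
  | |- smooth (fun _ => _ * _) => apply smooth_mult; smooth_tac
  | |- smooth (half _) => apply smooth_half; smooth_tac
  | |- smooth (lincomb _ _ _ _) => apply smooth_lincomb; smooth_tac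
  | _ => idtac
  end.

Lemma wint_smooth (e f u v : R -> R) :
  smooth e -> smooth f -> smooth u -> smooth v -> csmooth (wint e f u v).
Proof.
  intros. split.
  - apply (smooth_prim (fun y => e y * u y - f y * v y)). smooth_tac.
  - apply (smooth_prim (fun y => e y * v y + f y * u y)). smooth_tac.
Qed.

Lemma Dtheta_wint (e f u v : R -> R) (x : R) :
  smooth e -> smooth f -> smooth u -> smooth v ->
  Dtheta (wint e f u v) x =
  (e x * u x - f x * v x, e x * v x + f x * u x).
Proof.
  intros. unfold Dtheta. f_equal; apply is_derive_unique;
    [apply (is_derive_prim (fun y => e y * u y - f y * v y))
    |apply (is_derive_prim (fun y => e y * v y + f y * u y))];
    intros; apply smooth_continuous; smooth_tac.
Qed.

Lemma wint_0 (e f u v : R -> R) : wint e f u v 0 = 0%C.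
Proof. unfold wint. now rewrite !prim_0. Qed.

Lemma csmooth_eq (c d : R -> C) :
  csmooth c -> csmooth d -> (forall x, Dtheta c x = Dtheta d x) ->
  c 0 = d 0 -> c = d.
Proof.
  intros [c1 c2] [d1 d2] H H0. apply functional_extensionality. intros x.
  assert (K : forall F1 F2 : R -> R, smooth F1 -> smooth F2 ->
     (forall y, Derive F1 y = Derive F2 y) -> F1 0 = F2 0 -> F1 x = F2 x).
  { intros F1 F2 S1 S2 E E0.
    pose proof (prim_unique F1 (Derive F1) x) as P1.
    pose proof (prim_unique F2 (Derive F2) x) as P2.
    destruct (smooth_Derive F1 S1) as [T1 D1], (smooth_Derive F2 S2) as [T2 D2].
    rewrite (prim_ext _ _ x E) in P1.
    rewrite P2 in P1; auto; try (intros; now apply smooth_continuous).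
    - specialize (P1 (fun y => smooth_continuous _ y T1) D1). lra.
  }
  apply injective_projections.
  - apply (K (fun x => Re (c x)) (fun x => Re (d x))); auto.
    + intros y. exact (f_equal fst (H y)).
    + now rewrite H0.
  - apply (K (fun x => Im (c x)) (fun x => Im (d x))); auto.
    + intros y. exact (f_equal snd (H y)).
    + now rewrite H0.
Qed.

Lemma basic_curve_wint (e f : R -> R) :
  smooth e -> smooth f -> basic_curve e f = wint e f (half e) (half f).
Proof.
  intros He Hf. apply functional_extensionality; intros x. unfold basic_curve.
  rewrite (is_RInt_unique (V := C_R_CompleteNormedModule) _ 0 x
    (prim (fun y => e y * e y - f y * f y) x, prim (fun y => e y * f y + f y * e y) x)).
  - unfold wint. rewrite (prim_lin (fun y => e y * e y) (fun y => f y * f y)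
      (fun y => e y * half e y - f y * half f y) (/ 2) (- / 2) x);
      try (intros; apply smooth_continuous; smooth_tac);
      try (intros; unfold half; ring).
    rewrite (prim_lin (fun y => e y * e y) (fun y => f y * f y)
      (fun y => e y * e y - f y * f y) 1 (- 1) x);
      try (intros; apply smooth_continuous; smooth_tac); try (intros; ring).
    rewrite (prim_lin (fun y => e y * f y) (fun y => f y * e y)
      (fun y => e y * half f y + f y * half e y) (/ 2) (/ 2) x);
      try (intros; apply smooth_continuous; smooth_tac);
      try (intros; unfold half; ring).
    rewrite (prim_lin (fun y => e y * f y) (fun y => f y * e y)
      (fun y => e y * f y + f y * e y) 1 1 x);
      try (intros; apply smooth_continuous; smooth_tac); try (intros; ring).
    unfold Cmult, RtoC; simpl. f_equal; ring.
  - apply (is_RInt_ext (V := C_R_CompleteNormedModule)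
      (fun y => (e y * e y - f y * f y, e y * f y + f y * e y))).
    + intros y _. unfold Cmult, Cplus, RtoC, Ci; simpl. f_equal; ring.
    + apply (is_RInt_fct_extend_pair (U := R_NormedModule) (V := R_NormedModule));
        simpl.
      * apply (RInt_correct (fun y => e y * e y - f y * f y)), ex_RInt_cont.
        intros; apply smooth_continuous; smooth_tac.
      * apply (RInt_correct (fun y => e y * f y + f y * e y)), ex_RInt_cont.
        intros; apply smooth_continuous; smooth_tac.
Qed.

(** A product of two members of [V] is 2 PI-periodic for either parity, and the two conditions on
    inner products say that the integral of [(e + i f) (u + i v)] over a period vanishes. *)
Lemma wint_periodic (p : parity) (e f u v : R -> R) :
  inV p e -> inV p f -> inV p u -> inV p v ->
  inner e u = inner f v -> inner e v = - inner f u -> periodic (wint e f u v).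
Proof.
  intros He Hf Hu Hv H1 H2 x.
  assert (smooth e /\ smooth f /\ smooth u /\ smooth v) as (? & ? & ? & ?)
    by (split; [apply He|]; split; [apply Hf|]; split; [apply Hu|apply Hv]).
  assert (E1 : prim (fun y => e y * u y - f y * v y) (2 * PI) = 0).
  { rewrite (prim_lin (fun y => e y * u y) (fun y => f y * v y) _ 1 (-1));
      try (intros; apply smooth_continuous; smooth_tac); try (intros; ring).
    rewrite <- !inner_prim. lra. }
  assert (E2 : prim (fun y => e y * v y + f y * u y) (2 * PI) = 0).
  { rewrite (prim_lin (fun y => e y * v y) (fun y => f y * u y) _ 1 1);
      try (intros; apply smooth_continuous; smooth_tac); try (intros; ring).
    rewrite <- !inner_prim. lra. }
  unfold wint. rewrite !prim_period, E1, E2, !Rplus_0_r; auto;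
    try (intros; apply smooth_continuous; smooth_tac);
    intros; rewrite ?(inV_sq_period p) by assumption; reflexivity.
Qed.

Lemma Cmod_sum_sqr (x y m : R) : 0 <= m -> x * x + y * y = m * m -> Cmod (x, y) = m.
Proof.
  intros Hm E. unfold Cmod; simpl.
  replace (x * (x * 1) + y * (y * 1)) with (m * m) by lra.
  now apply sqrt_square.
Qed.

Lemma Cmod_basic_curve (e f : R -> R) (x : R) : smooth e -> smooth f ->
  Cmod (Dtheta (basic_curve e f) x) = / 2 * (e x * e x + f x * f x).
Proof.
  intros He Hf. rewrite basic_curve_wint, Dtheta_wint by smooth_tac.
  apply Cmod_sum_sqr; unfold half; [|field].
  pose proof (Rle_0_sqr (e x)); pose proof (Rle_0_sqr (f x)); unfold Rsqr in *; lra.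
Qed.

Lemma length_basic_curve (e f : R -> R) : smooth e -> smooth f ->
  curve_length (basic_curve e f) = / 2 * (inner e e + inner f f).
Proof.
  intros He Hf. change (curve_length (basic_curve e f)) with
    (prim (fun x => Cmod (Dtheta (basic_curve e f) x)) (2 * PI)).
  rewrite (prim_lin (fun y => e y * e y) (fun y => f y * f y) _ (/ 2) (/ 2));
    try (intros; apply smooth_continuous; smooth_tac).
  - rewrite <- !inner_prim. ring.
  - intros y. rewrite Cmod_basic_curve by assumption. ring.
Qed.

Lemma Cdiv_RtoC (z : C) (m : R) :
  m <> 0 -> (z / RtoC m)%C = (fst z / m, snd z / m).
Proof.
  intros H. destruct z as [a b]. unfold Cdiv, Cmult, Cinv, RtoC; simpl.
  f_equal; field; exact H.
Qed.

(* With [h' = w dw] and [c' = w ^ 2 / 2], [|h'| ^ 2 / |c'| = 2 |dw| ^ 2]. *)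
Lemma G_wint (e f u v u' v' : R -> R) :
  smooth e -> smooth f -> smooth u -> smooth v -> smooth u' -> smooth v' ->
  orthonormal e f -> (forall x, e x * e x + f x * f x <> 0) ->
  G (basic_curve e f) (wint e f u v) (wint e f u' v') =
  2 * (inner u u' + inner v v').
Proof.
  intros He Hf Hu Hv Hu' Hv' (O1 & O2 & O3) Hn. unfold G.
  rewrite length_basic_curve, O1, O2 by assumption.
  replace (/ (/ 2 * (1 + 1))) with 1 by field. rewrite Rmult_1_l.
  match goal with |- RInt ?g _ _ = _ =>
    change (prim g (2 * PI) = 2 * (inner u u' + inner v v')) end.
  rewrite (prim_lin (fun y => u y * u' y) (fun y => v y * v' y) _ 2 2);
    try (intros; apply smooth_continuous; smooth_tac).
  - rewrite <- !inner_prim. ring.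
  - intros y. unfold Ds. rewrite Cmod_basic_curve by assumption.
    specialize (Hn y).
    rewrite !Cdiv_RtoC by lra. rewrite !Dtheta_wint by assumption.
    unfold Cmult, Cconj, Re; simpl. field. lra.
Qed.

Lemma Im_Cdiv (z z' : C) :
  fst z * fst z + snd z * snd z <> 0 ->
  Im (z' / z)%C = (fst z * snd z' - snd z * fst z') / (fst z * fst z + snd z * snd z).
Proof.
  intros H. destruct z as [a b], z' as [a' b']. simpl in *.
  unfold Cdiv, Cmult, Cinv, Im; simpl. field. 
  intros E. apply H. lra.
Qed.

Lemma Dtheta_neq0 (c : R -> C) (x : R) :
  Dtheta c x <> 0%C <->
  fst (Dtheta c x) * fst (Dtheta c x) + snd (Dtheta c x) * snd (Dtheta c x) <> 0.
Proof.
  split; intros H E; apply H.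
  - apply sum_sqr_0 in E. destruct E as [E1 E2].
    now apply injective_projections.
  - rewrite E. simpl. ring.
Qed.

Lemma winding_number_argd (c : R -> C) (k : Z) :
  (forall x, Dtheta c x <> 0%C) ->
  (winding_number (Dtheta c) k <->
   prim (argd (fun x => fst (Dtheta c x)) (fun x => snd (Dtheta c x))) (2 * PI)
     = 2 * PI * IZR k).
Proof.
  intros Hn. unfold winding_number.
  rewrite (prim_ext (argd _ _) (fun x => Im (Dtheta (Dtheta c) x / Dtheta c x)%C)).
  - reflexivity.
  - intros x. rewrite Im_Cdiv by now apply Dtheta_neq0. reflexivity.
Qed.

(** Along one period [w = e + i f] is multiplied by a sign [t], and in polar form by [A exp (i B)].
    So [A exp (i B) = t]: the angle [B] is a multiple of PI whose parity is read off from the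
    sign. *)
Lemma inV_total_arg (p : parity) (e f : R -> R) :
  inV p e -> inV p f -> (forall x, e x * e x + f x * f x <> 0) ->
  exists k : Z, prim (argd e f) (2 * PI) = IZR k * PI /\
    match p with even => Z.Even k | odd => Z.Odd k end.
Proof.
  intros He Hf Hn.
  set (t := match p with even => 1 | odd => -1 end).
  assert (Ee : e (2 * PI) = t * e 0).
  { rewrite <- (Rplus_0_l (2 * PI)). destruct He as [_ ->].
    unfold t; destruct p; ring. }
  assert (Ef : f (2 * PI) = t * f 0).
  { rewrite <- (Rplus_0_l (2 * PI)). destruct Hf as [_ ->].
    unfold t; destruct p; ring. }
  destruct (polar_lift e f (proj1 He) (proj1 Hf) Hn (2 * PI)) as [E1 E2].
  rewrite Ee in E1. rewrite Ef in E2.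
  set (A := exp (prim (logd e f) (2 * PI))) in *.
  set (B := prim (argd e f) (2 * PI)) in *.
  assert (PA : 0 < A) by apply exp_pos.
  specialize (Hn 0).
  (* [C1] and [C2] come from multiplying [w (2 PI) = A exp (i B) w 0] by the conjugate of [w 0] and
     dividing by [|w 0|^2]. *)
  assert (C1 : A * cos B = t).
  { apply Rmult_eq_reg_r with (e 0 * e 0 + f 0 * f 0); auto.
    transitivity (e 0 * (A * (e 0 * cos B - f 0 * sin B)) +
      f 0 * (A * (e 0 * sin B + f 0 * cos B))); [ring|].
    rewrite <- E1, <- E2. ring. }
  assert (C2 : A * sin B = 0).
  { apply Rmult_eq_reg_r with (e 0 * e 0 + f 0 * f 0); auto.
    transitivity (e 0 * (A * (e 0 * sin B + f 0 * cos B)) -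
      f 0 * (A * (e 0 * cos B - f 0 * sin B))); [ring|].
    rewrite <- E1, <- E2. ring. }
  apply Rmult_integral in C2. destruct C2 as [C2|C2]; [lra|].
  apply sin_eq_0_0 in C2. destruct C2 as [k Hk]. exists k. split; [exact Hk|].
  rewrite Hk in C1. destruct (sin_cos_int k) as (_ & Kev & Kod).
  destruct (Z.Even_or_Odd k) as [K|K]; unfold t in C1.
  - rewrite (Kev K) in C1. destruct p; [exact K|lra].
  - rewrite (Kod K) in C1. destruct p; [lra|exact K].
Qed.

Lemma basic_curve_normalized (p : parity) (e f : R -> R) :
  inV p e -> inV p f -> orthonormal e f ->
  (forall x, e x * e x + f x * f x <> 0) -> normalized p (basic_curve e f).
Proof.
  intros He Hf (O1 & O2 & O3) Hn.
  assert (Se : smooth e) by apply He. assert (Sf : smooth f) by apply Hf.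
  assert (D : forall x, Dtheta (basic_curve e f) x =
     (/ 2 * (e x * e x - f x * f x), e x * f x)).
  { intros x. rewrite basic_curve_wint, Dtheta_wint by smooth_tac.
    unfold half; f_equal; field. }
  (* [|c'|^2] is the square of [|w|^2 / 2]. *)
  assert (N : forall x, Dtheta (basic_curve e f) x <> 0%C).
  { intros x. apply Dtheta_neq0. rewrite D. simpl. intros E. apply (Hn x).
    apply Rsqr_0_uniq. unfold Rsqr. lra. }
  split; [|split].
  - split; [|split; [|split]].
    + rewrite basic_curve_wint by assumption. apply wint_smooth; smooth_tac.
    + rewrite basic_curve_wint by assumption.
      assert (HV : forall g, inV p g -> inV p (half g)).
      { intros g Hg. replace (half g) with (lincomb (/ 2) g 0 g).
        - now apply inV_lincomb.
        - apply functional_extensionality; intros; unfold lincomb, half; ring. }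
      apply wint_periodic with p; auto;
        rewrite !inner_half, ?O1, ?O2, ?(inner_sym f e), ?O3 by assumption; ring.
    + exact N.
    + destruct (inV_total_arg p e f He Hf Hn) as (k & Hk & Hp).
      exists k. split; [|exact Hp].
      apply winding_number_argd; [exact N|].
      replace (fun x : R => fst (Dtheta (basic_curve e f) x)) with
        (fun x => / 2 * (e x * e x - f x * f x))
        by (apply functional_extensionality; intros; now rewrite D).
      replace (fun x : R => snd (Dtheta (basic_curve e f) x)) with
        (fun x => e x * f x)
        by (apply functional_extensionality; intros; now rewrite D).
      (* The argument of [w^2 / 2] moves twice as fast as that of [w]; a total of [k PI] for [w]
         therefore makes [k] the winding number of [c']. *)
      rewrite (prim_lin (argd e f) (argd e f) _ 2 0);
        try (intros; now apply smooth_continuous, smooth_argd).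
      * rewrite Hk. ring.
      * intros x. unfold argd.
        destruct (smooth_Derive e Se) as [_ De], (smooth_Derive f Sf) as [_ Df].
        assert (E1 : Derive (fun y : R => e y * f y) x =
          Derive e x * f x + e x * Derive f x).
        { apply is_derive_unique, is_derive_Rmult; auto. }
        assert (E2 : Derive (fun y : R => / 2 * (e y * e y - f y * f y)) x =
          e x * Derive e x - f x * Derive f x).
        { apply is_derive_unique. eapply is_derive_value.
          - apply (is_derive_scal (fun x => e x * e x - f x * f x) x (/ 2)).
            apply (is_derive_minus (fun x => e x * e x) (fun x => f x * f x));
              apply is_derive_Rmult; auto.
          - unfold minus, plus, opp; simpl. field. }
        rewrite E1, E2. specialize (Hn x). field. split; [exact Hn|].
        intros E. apply Hn, Rsqr_0_uniq. unfold Rsqr. lra.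
  - rewrite basic_curve_wint by assumption. apply wint_0.
  - rewrite length_basic_curve, O1, O2 by assumption. field.
Qed.

(** * Lifting a family of curves to its square root *)

Lemma smooth2_argd_logd (a b : R -> R -> R) : smooth2 a -> smooth2 b ->
  (forall s x, a s x * a s x + b s x * b s x <> 0) ->
  smooth2 (fun s => logd (a s) (b s)) /\ smooth2 (fun s => argd (a s) (b s)).
Proof.
  intros Ha Hb Hn.
  destruct (smooth2_pdx a Ha) as [Ha' _], (smooth2_pdx b Hb) as [Hb' _].
  assert (D : smooth2 (fun s x => a s x * a s x + b s x * b s x))
    by (apply smooth2_plus; now apply smooth2_mult).
  split.
  - apply (smooth2_div (fun s x => a s x * pdx a s x + b s x * pdx b s x) _ Hn);
      [|exact D].
    apply (smooth2_plus (fun s x => a s x * pdx a s x)); now apply smooth2_mult.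
  - apply (smooth2_div (fun s x => a s x * pdx b s x - b s x * pdx a s x) _ Hn);
      [|exact D].
    apply (smooth2_minus (fun s x => a s x * pdx b s x)); now apply smooth2_mult.
Qed.

(* Polar coordinates along the path from [(0, 0)] to [(s, 0)] to [(s, x)]. *)
Lemma polar_lift2 (a b : R -> R -> R) : smooth2 a -> smooth2 b ->
  (forall s x, a s x * a s x + b s x * b s x <> 0) ->
  exists A B : R -> R -> R, smooth2 A /\ smooth2 B /\
    (forall s x, A s x = A s 0 + prim (logd (a s) (b s)) x) /\
    (forall s x, B s x = B s 0 + prim (argd (a s) (b s)) x) /\
    (forall s x,
      a s x = exp (A s x) * (a 0 0 * cos (B s x) - b 0 0 * sin (B s x)) /\
      b s x = exp (A s x) * (a 0 0 * sin (B s x) + b 0 0 * cos (B s x))).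
Proof.
  intros Ha Hb Hn.
  set (a0 := fun s => a s 0). set (b0 := fun s => b s 0).
  assert (Ha0 : smooth a0) by exact (smooth2_smooth _ 0 (smooth2_swap a Ha)).
  assert (Hb0 : smooth b0) by exact (smooth2_smooth _ 0 (smooth2_swap b Hb)).
  assert (Hn0 : forall s, a0 s * a0 s + b0 s * b0 s <> 0) by (intros; apply Hn).
  destruct (smooth2_argd_logd a b Ha Hb Hn) as [SL SA].
  exists (fun s x => prim (logd a0 b0) s + prim (logd (a s) (b s)) x),
         (fun s x => prim (argd a0 b0) s + prim (argd (a s) (b s)) x).
  repeat split.
  - apply smooth2_plus; [|now apply (smooth2_prim (fun s => logd (a s) (b s)))].
    apply (smooth2_swap (fun _ s => prim (logd a0 b0) s)), smooth_smooth2,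
      smooth_prim. now apply smooth_logd.
  - apply smooth2_plus; [|now apply (smooth2_prim (fun s => argd (a s) (b s)))].
    apply (smooth2_swap (fun _ s => prim (argd a0 b0) s)), smooth_smooth2,
      smooth_prim. now apply smooth_argd.
  - intros. rewrite prim_0. ring.
  - intros. rewrite prim_0. ring.
  - destruct (polar_lift (a s) (b s) (smooth2_smooth a s Ha)
      (smooth2_smooth b s Hb) (Hn s) x) as [-> _].
    destruct (polar_lift a0 b0 Ha0 Hb0 Hn0 s) as [E1 E2].
    change (a s 0) with (a0 s). change (b s 0) with (b0 s).
    change (a 0 0) with (a0 0). change (b 0 0) with (b0 0).
    rewrite E1, E2, exp_plus, cos_plus, sin_plus. ring.
  - destruct (polar_lift (a s) (b s) (smooth2_smooth a s Ha)
      (smooth2_smooth b s Hb) (Hn s) x) as [_ ->].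
    destruct (polar_lift a0 b0 Ha0 Hb0 Hn0 s) as [E1 E2].
    change (a s 0) with (a0 s). change (b s 0) with (b0 s).
    change (a 0 0) with (a0 0). change (b 0 0) with (b0 0).
    rewrite E1, E2, exp_plus, cos_plus, sin_plus. ring.
Qed.

Lemma half_angle (t : R) :
  cos t = cos (/ 2 * t) * cos (/ 2 * t) - sin (/ 2 * t) * sin (/ 2 * t) /\
  sin t = 2 * sin (/ 2 * t) * cos (/ 2 * t).
Proof.
  (* Occurrences 1 and 6 are the left-hand sides [cos t] and [sin t]. *)
  replace t with (2 * (/ 2 * t)) at 1 6 by field.
  now rewrite cos_2a, sin_2a.
Qed.

Lemma complex_polar (a b : R) :
  exists r t, 0 <= r /\ a = r * cos t /\ b = r * sin t /\ r * r = a * a + b * b.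
Proof.
  set (r := sqrt (a * a + b * b)).
  assert (Hr : r * r = a * a + b * b).
  { apply sqrt_sqrt. pose proof (Rle_0_sqr a); pose proof (Rle_0_sqr b).
    unfold Rsqr in *; lra. }
  assert (P : 0 <= r) by apply sqrt_pos.
  destruct (Req_dec r 0) as [E|E].
  - exists 0, 0. rewrite E in Hr.
    destruct (sum_sqr_0 a b) as [-> ->]; [lra|]. lra.
  - destruct (unit_angle (a / r) (b / r)) as (t & E1 & E2).
    { transitivity ((a * a + b * b) / (r * r)); [field; exact E|].
      rewrite Hr. apply Rdiv_diag. rewrite <- Hr.
      now apply Rmult_integral_contrapositive. }
    exists r, t. rewrite <- E1, <- E2. repeat split; auto; field; exact E.
Qed.

(** [m + i n] is a square root of [2 (a + i b)]; it will be the initial value of the lift. *)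
Lemma complex_sqrt (a b : R) :
  exists m n, m * m - n * n = 2 * a /\ m * n = b.
Proof.
  destruct (complex_polar a b) as (r & t & Hr & -> & -> & _).
  destruct (half_angle t) as [E1 E2].
  assert (S : sqrt (2 * r) * sqrt (2 * r) = 2 * r) by (apply sqrt_sqrt; lra).
  exists (sqrt (2 * r) * cos (/ 2 * t)), (sqrt (2 * r) * sin (/ 2 * t)).
  split.
  - rewrite E1. transitivity ((sqrt (2 * r) * sqrt (2 * r)) *
      (cos (/ 2 * t) * cos (/ 2 * t) - sin (/ 2 * t) * sin (/ 2 * t))); [ring|].
    rewrite S; ring.
  - rewrite E2. transitivity ((sqrt (2 * r) * sqrt (2 * r)) *
      (sin (/ 2 * t) * cos (/ 2 * t))); [ring|].
    rewrite S; ring.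
Qed.

Lemma exp_half (t : R) : exp (/ 2 * t) * exp (/ 2 * t) = exp t.
Proof. rewrite <- exp_plus. f_equal; field. Qed.

Lemma Derive_period (f : R -> R) (T x : R) : smooth f ->
  (forall y, f (y + T) = f y) -> Derive f (x + T) = Derive f x.
Proof.
  intros Hf HT. symmetry. apply is_derive_unique.
  apply (is_derive_ext (fun y => f (y + T)) f); [exact HT|].
  apply is_derive_shift. now apply smooth_Derive.
Qed.

(** The modulus of a closed loop returns to its value while the argument gains 2 PI per turn; after
    halving the argument, the gain [k PI] decides between periodic and antiperiodic. *)
Lemma polar_period (a b : R -> R) (k : Z) (T : R) : smooth a -> smooth b ->
  (forall x, a x * a x + b x * b x <> 0) ->
  (forall x, a (x + T) = a x) -> (forall x, b (x + T) = b x) ->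
  prim (argd a b) T = 2 * PI * IZR k ->
  forall x, prim (logd a b) (x + T) = prim (logd a b) x /\
    prim (argd a b) (x + T) = prim (argd a b) x + 2 * (IZR k * PI).
Proof.
  intros Ha Hb Hn Pa Pb Hk x.
  assert (E : prim (logd a b) T = 0).
  { destruct (polar_lift a b Ha Hb Hn T) as [E1 E2].
    rewrite Hk in E1, E2.
    replace (2 * PI * IZR k) with (IZR (2 * k) * PI) in E1, E2
      by (rewrite mult_IZR; ring).
    destruct (sin_cos_int (2 * k)) as (Z1 & Z2 & _).
    rewrite Z1, Z2 in E1, E2 by now exists k.
    rewrite <- (Rplus_0_l T), Pa in E1 at 1.
    rewrite <- (Rplus_0_l T), Pb in E2 at 1.
    apply exp_inv. rewrite exp_0. specialize (Hn 0).
    set (X := exp (prim (logd a b) T)) in *.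
    apply Rmult_eq_reg_r with (a 0 * a 0 + b 0 * b 0); auto.
    transitivity (a 0 * (X * (a 0 * 1 - b 0 * 0)) +
      b 0 * (X * (a 0 * 0 + b 0 * 1))); [ring|].
    rewrite <- E1, <- E2. ring. }
  assert (Da : forall y, Derive a (y + T) = Derive a y)
    by (intros y; now apply Derive_period).
  assert (Db : forall y, Derive b (y + T) = Derive b y)
    by (intros y; now apply Derive_period).
  split.
  - rewrite prim_period, E.
    + ring.
    + intros y. apply smooth_continuous. exact (smooth_logd a b Ha Hb Hn).
    + intros y. unfold logd. now rewrite Pa, Pb, Da, Db.
  - rewrite prim_period, Hk.
    + ring.
    + intros y. apply smooth_continuous. exact (smooth_argd a b Ha Hb Hn).
    + intros y. unfold argd. now rewrite Pa, Pb, Da, Db.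
Qed.

(** Stated for families because smooth curves of the quotient have to be lifted; constant families
    give surjectivity. *)
Lemma sqrt_lift (p : parity) (c : R -> R -> C) :
  csmooth2 c -> (forall s, normalized p (c s)) ->
  exists e f : R -> R -> R, smooth2 e /\ smooth2 f /\
    forall s, inV p (e s) /\ inV p (f s) /\ orthonormal (e s) (f s) /\
      (forall x, e s x * e s x + f s x * f s x <> 0) /\
      basic_curve (e s) (f s) = c s.
Proof.
  intros [Sr Si] Hc.
  set (a := pdx (fun s x => Re (c s x))). set (b := pdx (fun s x => Im (c s x))).
  assert (Ha : smooth2 a) by now apply smooth2_pdx.
  assert (Hb : smooth2 b) by now apply smooth2_pdx.
  assert (Hn : forall s x, a s x * a s x + b s x * b s x <> 0).
  { intros s x. destruct (Hc s) as [(_ & _ & N & _) _].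
    now apply (proj1 (Dtheta_neq0 (c s) x)). }
  destruct (polar_lift2 a b Ha Hb Hn) as (A & B & HA & HB & EA & EB & Eab).
  destruct (complex_sqrt (a 0 0) (b 0 0)) as (m & n & Hmn1 & Hmn2).
  destruct smooth_sin_cos as [Ssin Scos].
  assert (HA2 : smooth2 (fun s x => exp (/ 2 * A s x))).
  { apply (smooth2_comp exp (fun s x => / 2 * A s x)); [apply smooth_exp|].
    apply (smooth2_mult (fun _ _ => / 2)); auto using smooth2_const. }
  assert (HB2 : smooth2 (fun s x => / 2 * B s x))
    by (apply (smooth2_mult (fun _ _ => / 2)); auto using smooth2_const).
  assert (HC2 : smooth2 (fun s x => cos (/ 2 * B s x)))
    by exact (smooth2_comp cos _ Scos HB2).
  assert (HS2 : smooth2 (fun s x => sin (/ 2 * B s x)))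
    by exact (smooth2_comp sin _ Ssin HB2).
  (* [e + i f = (m + i n) exp ((A + i B) / 2)]: halving the exponent extracts the root, and
     [m + i n] is the root at [(0, 0)]. *)
  set (e := fun s x => exp (/ 2 * A s x) *
    (m * cos (/ 2 * B s x) - n * sin (/ 2 * B s x))).
  set (f := fun s x => exp (/ 2 * A s x) *
    (m * sin (/ 2 * B s x) + n * cos (/ 2 * B s x))).
  assert (He : smooth2 e).
  { apply smooth2_mult; [exact HA2|].
    apply smooth2_minus; apply (smooth2_mult (fun _ _ => _));
      auto using smooth2_const. }
  assert (Hf : smooth2 f).
  { apply smooth2_mult; [exact HA2|].
    apply smooth2_plus; apply (smooth2_mult (fun _ _ => _));
      auto using smooth2_const. }
  assert (E1 : forall s x, e s x * e s x - f s x * f s x = 2 * a s x).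
  { intros s x. destruct (Eab s x) as [-> _]. unfold e, f.
    destruct (half_angle (B s x)) as [-> ->].
    rewrite <- (exp_half (A s x)), <- Hmn2.
    replace (a 0 0) with ((m * m - n * n) / 2) by lra. field. }
  assert (E2 : forall s x, e s x * f s x = b s x).
  { intros s x. destruct (Eab s x) as [_ ->]. unfold e, f.
    destruct (half_angle (B s x)) as [-> ->].
    rewrite <- (exp_half (A s x)), <- Hmn2.
    replace (a 0 0) with ((m * m - n * n) / 2) by lra. field. }
  assert (Hnef : forall s x, e s x * e s x + f s x * f s x <> 0).
  { intros s x E. apply sum_sqr_0 in E. destruct E as [Z1 Z2].
    apply (Hn s x). rewrite <- E2. specialize (E1 s x). rewrite Z1, Z2 in *. nra. }
  assert (Hcs : forall s, basic_curve (e s) (f s) = c s).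
  { intros s. assert (Se := smooth2_smooth e s He).
    assert (Sf := smooth2_smooth f s Hf).
    rewrite basic_curve_wint by assumption.
    apply csmooth_eq.
    - apply wint_smooth; auto using smooth_half.
    - split; [exact (smooth2_smooth _ s Sr)|exact (smooth2_smooth _ s Si)].
    - intros x. rewrite Dtheta_wint by auto using smooth_half.
      unfold half. specialize (E1 s x). specialize (E2 s x).
      change (Dtheta (c s) x) with (a s x, b s x). f_equal; lra.
    - rewrite wint_0. symmetry. apply (Hc s). }
  exists e, f. split; [exact He|]. split; [exact Hf|]. intros s.
  assert (Se := smooth2_smooth e s He). assert (Sf := smooth2_smooth f s Hf).
  destruct (Hc s) as [(_ & Hper & N & k & Hk & Hpar) [Hc0 Hlen]].
  apply (proj1 (winding_number_argd (c s) k N)) in Hk.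
  change (prim (argd (a s) (b s)) (2 * PI) = 2 * PI * IZR k) in Hk.
  assert (Pa : forall x, a s (x + 2 * PI) = a s x).
  { intros x. apply (Derive_period (fun y => Re (c s y))).
    - exact (smooth2_smooth _ s Sr).
    - intros y. now rewrite Hper. }
  assert (Pb : forall x, b s (x + 2 * PI) = b s x).
  { intros x. apply (Derive_period (fun y => Im (c s y))).
    - exact (smooth2_smooth _ s Si).
    - intros y. now rewrite Hper. }
  assert (Per := polar_period (a s) (b s) k (2 * PI) (smooth2_smooth a s Ha)
    (smooth2_smooth b s Hb) (Hn s) Pa Pb Hk).
  assert (PA : forall x, A s (x + 2 * PI) = A s x).
  { intros x. rewrite (EA s x), EA. destruct (Per x) as [-> _]. reflexivity. }
  (* Half of the gain [2 k PI]; it multiplies [e] and [f] by [cos (k PI) = (-1)^k], the sign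
     required by the parity. *)
  assert (PB : forall x, / 2 * B s (x + 2 * PI) = / 2 * B s x + IZR k * PI).
  { intros x. rewrite (EB s x), EB. destruct (Per x) as [_ ->]. field. }
  destruct (sin_cos_int k) as (K0 & Kev & Kod).
  assert (Hs : forall g, (forall x, g (x + 2 * PI) = cos (IZR k * PI) * g x) ->
    forall x, g (x + 2 * PI) = match p with even => g x | odd => - g x end).
  { intros g Hg x. rewrite Hg. destruct p.
    - rewrite (Kev Hpar). ring.
    - rewrite (Kod Hpar). ring. }
  assert (Ve : inV p (e s)).
  { split; [exact Se|]. apply Hs. intros x. unfold e.
    rewrite PA, PB, cos_plus, sin_plus, K0. ring. }
  assert (Vf : inV p (f s)).
  { split; [exact Sf|]. apply Hs. intros x. unfold f.
    rewrite PA, PB, cos_plus, sin_plus, K0. ring. }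
  split; [exact Ve|]. split; [exact Vf|]. split; [|split; [apply Hnef|apply Hcs]].
  (* Closedness gives equal norms (real part) and orthogonality (imaginary part); the unit length
     makes the sum of the squared norms equal to 2. *)
  assert (Z : c s (2 * PI) = 0%C).
  { rewrite <- Hc0, <- (Rplus_0_l (2 * PI)). apply Hper. }
  rewrite <- Hcs in Hlen, Z.
  rewrite length_basic_curve in Hlen by assumption.
  rewrite basic_curve_wint in Z by assumption. unfold wint in Z.
  assert (Z1 := f_equal fst Z). assert (Z2 := f_equal snd Z). simpl in Z1, Z2.
  rewrite (prim_lin (fun y => e s y * e s y) (fun y => f s y * f s y) _ (/ 2) (- / 2))
    in Z1;
    try (intros; apply smooth_continuous; smooth_tac);
    try (intros; unfold half; ring).
  rewrite (prim_lin (fun y => e s y * f s y) (fun y => e s y * f s y) _ (/ 2) (/ 2))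
    in Z2;
    try (intros; apply smooth_continuous; smooth_tac);
    try (intros; unfold half; ring).
  rewrite <- !inner_prim in Z2.
  rewrite <- (inner_prim (e s) (e s)), <- (inner_prim (f s) (f s)) in Z1.
  unfold orthonormal. lra.
Qed.

(** * Similitudes and similarity classes *)

(** For [sigma = 1] the identity, for [sigma = -1] complex conjugation. *)
Definition cflip (sigma : R) (z : C) : C := (fst z, sigma * snd z).

Lemma sign_ok_mult (r : bool) (s s' : R) :
  sign_ok r s -> sign_ok r s' -> sign_ok r (s * s').
Proof.
  intros [-> | [-> ->]] [-> | [E ->]]; unfold sign_ok;
    try (left; ring); right; split; trivial; ring.
Qed.

(** Normal form. Under composition [cflip s1] moves past the inner coefficients because conjugation
    respects sums and products. *)
Lemma similitude_affine (r : bool) (g : C -> C) : similitude r g ->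
  exists (l b : C) (sigma : R), sign_ok r sigma /\
    forall z, g z = (l * cflip sigma z + b)%C.
Proof.
  induction 1 as [b|a|l Hl|Hr|g h _ (l1 & b1 & s1 & H1 & E1) _
    (l2 & b2 & s2 & H2 & E2)].
  - exists 1%C, b, 1. split; [now left|]. intros [x y].
    unfold cflip, Cmult, Cplus, RtoC; simpl; f_equal; ring.
  - exists (expi a), 0%C, 1. split; [now left|]. intros [x y].
    unfold cflip, Cmult, Cplus, RtoC; simpl; f_equal; ring.
  - exists (RtoC l), 0%C, 1. split; [now left|]. intros [x y].
    unfold cflip, Cmult, Cplus, RtoC; simpl; f_equal; ring.
  - exists 1%C, 0%C, (-1). split; [now right|]. intros [x y].
    unfold cflip, Cconj, Cmult, Cplus, RtoC; simpl; f_equal; ring.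
  - exists (l1 * cflip s1 l2)%C, (l1 * cflip s1 b2 + b1)%C, (s1 * s2).
    split; [now apply sign_ok_mult|].
    intros [x y]. rewrite E1, E2. pose proof (sign_ok_sqr r s1 H1) as Q.
    destruct l1, l2, b1, b2. unfold cflip, Cmult, Cplus; simpl.
    destruct H1 as [-> | [_ ->]]; f_equal; ring.
Qed.

Lemma similitude_inverse (r : bool) (g : C -> C) : similitude r g ->
  exists g', similitude r g' /\ forall z, g' (g z) = z.
Proof.
  induction 1 as [b|a|l Hl|Hr|g h _ (g' & H1 & E1) _ (h' & H2 & E2)].
  - exists (fun z => z + - b)%C. split; [constructor|]. intros z. ring.
  - exists (fun z => expi (- a) * z)%C. split; [constructor|].
    intros [x y]. unfold expi, Cmult; simpl.
    rewrite cos_neg, sin_neg. pose proof (sin2_cos2 a) as T. unfold Rsqr in T.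
    f_equal.
    + transitivity ((sin a * sin a + cos a * cos a) * x); [ring|].
      rewrite T; ring.
    + transitivity ((sin a * sin a + cos a * cos a) * y); [ring|].
      rewrite T; ring.
  - exists (fun z => RtoC (/ l) * z)%C.
    split; [constructor; now apply Rinv_0_lt_compat|].
    intros [x y]. unfold Cmult, RtoC; simpl; f_equal; field; lra.
  - exists Cconj. split; [now constructor|]. intros [x y].
    unfold Cconj; simpl; f_equal; ring.
  - exists (fun z => h' (g' z)). split; [now apply (sim_comp r h' g')|].
    intros z. now rewrite E1, E2.
Qed.

Lemma sim_class_eq (r : bool) (p : parity) (c c' : R -> C) :
  Imm p c -> sim_class r p c c' -> sim_class r p c = sim_class r p c'.
Proof.
  intros Hc [Hc' (g & Hg & ->)].
  destruct (similitude_inverse r g Hg) as (g' & Hg' & E).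
  apply functional_extensionality; intros d. apply propositional_extensionality.
  split; intros [Hd (h & Hh & ->)]; (split; [exact Hd|]).
  - exists (fun z => h (g' z)). split; [now apply (sim_comp r h g')|].
    apply functional_extensionality; intros x. now rewrite E.
  - exists (fun z => h (g z)). split; [now apply (sim_comp r h g)|reflexivity].
Qed.

Lemma ImmSim_class (r : bool) (p : parity) (A : ImmSim r p) (c : R -> C) :
  proj1_sig A c -> proj1_sig A = sim_class r p c.
Proof.
  destruct A as [A (c0 & Hc0 & ->)]. simpl. now apply sim_class_eq.
Qed.

Lemma sig_eq {T : Type} (P : T -> Prop) (a b : {x | P x}) :
  proj1_sig a = proj1_sig b -> a = b.
Proof.
  apply eq_sig_hprop. intros; apply Classical_Prop.proof_irrelevance.
Qed.

Lemma ImmSim_eq (r : bool) (p : parity) (A B : ImmSim r p) (c : R -> C) :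
  proj1_sig A c -> proj1_sig B c -> A = B.
Proof.
  intros HA HB. apply sig_eq.
  now rewrite (ImmSim_class r p A c HA), (ImmSim_class r p B c HB).
Qed.

Lemma smooth_scale (a : R) (f : R -> R) : smooth f -> smooth (fun x => a * f x).
Proof. intros. apply (smooth_mult (fun _ => a)); auto using smooth_const. Qed.

Lemma affine_smooth (l b : C) (sigma : R) (c : R -> C) : csmooth c ->
  csmooth (fun x => l * cflip sigma (c x) + b)%C.
Proof.
  intros [H1 H2]. destruct l as [l1 l2], b as [b1 b2]. split.
  - apply (smooth_plus (fun x => l1 * Re (c x) - l2 * (sigma * Im (c x))) (fun _ => b1));
      [|apply smooth_const].
    apply (smooth_minus (fun x => l1 * Re (c x)) (fun x => l2 * (sigma * Im (c x))));
      [apply smooth_scale, H1|apply smooth_scale, smooth_scale, H2].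
  - apply (smooth_plus (fun x => l1 * (sigma * Im (c x)) + l2 * Re (c x)) (fun _ => b2));
      [|apply smooth_const].
    apply (smooth_plus (fun x => l1 * (sigma * Im (c x))) (fun x => l2 * Re (c x)));
      [apply smooth_scale, smooth_scale, H2|apply smooth_scale, H1].
Qed.

Lemma Dtheta_affine (l b : C) (sigma : R) (c : R -> C) (x : R) : csmooth c ->
  Dtheta (fun x => l * cflip sigma (c x) + b)%C x = (l * cflip sigma (Dtheta c x))%C.
Proof.
  intros [H1 H2]. destruct l as [l1 l2], b as [b1 b2].
  destruct (smooth_Derive _ H1) as [_ D1], (smooth_Derive _ H2) as [_ D2].
  specialize (D1 x). specialize (D2 x).
  unfold Dtheta at 1, cflip, Cmult, Cplus, Re, Im; simpl.
  f_equal; apply is_derive_unique; eapply is_derive_value.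
  - apply (is_derive_Rplus _ (fun _ => b1)); [|exact (is_derive_const b1 x)].
    apply (is_derive_minus (fun x => l1 * Re (c x)) (fun x => l2 * (sigma * Im (c x))));
      [apply is_derive_scal, D1|apply is_derive_scal, is_derive_scal, D2].
  - unfold minus, plus, opp, zero, Re, Im; simpl. ring.
  - apply (is_derive_Rplus _ (fun _ => b2)); [|exact (is_derive_const b2 x)].
    apply (is_derive_Rplus (fun x => l1 * (sigma * Im (c x))) (fun x => l2 * Re (c x)));
      [apply is_derive_scal, is_derive_scal, D2|apply is_derive_scal, D1].
  - unfold zero, Re, Im; simpl. ring.
Qed.

Lemma Cmod_cflip (sigma : R) (z : C) : sigma * sigma = 1 -> Cmod (cflip sigma z) = Cmod z.
Proof.
  intros H. unfold Cmod, cflip; simpl. f_equal.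
  transitivity (fst z * fst z + (sigma * sigma) * (snd z * snd z)); [ring|].
  rewrite H; ring.
Qed.

Lemma Cmod_Dtheta_continuous (c : R -> C) (x : R) : csmooth c ->
  continuous (fun x => Cmod (Dtheta c x)) x.
Proof.
  intros [H1 H2].
  destruct (smooth_Derive _ H1) as [S1 _], (smooth_Derive _ H2) as [S2 _].
  unfold Cmod.
  apply (continuous_comp (fun x => fst (Dtheta c x) ^ 2 + snd (Dtheta c x) ^ 2) sqrt).
  - apply (smooth_continuous (fun x => fst (Dtheta c x) ^ 2 + snd (Dtheta c x) ^ 2)).
    apply smooth_plus.
    + apply (smooth_mult (fun x => fst (Dtheta c x))); [exact S1|].
      apply (smooth_mult (fun x => fst (Dtheta c x))); [exact S1|apply smooth_const].
    + apply (smooth_mult (fun x => snd (Dtheta c x))); [exact S2|].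
      apply (smooth_mult (fun x => snd (Dtheta c x))); [exact S2|apply smooth_const].
  - apply continuity_pt_filterlim, continuity_pt_sqrt.
    pose proof (pow2_ge_0 (fst (Dtheta c x))). pose proof (pow2_ge_0 (snd (Dtheta c x))).
    simpl in *. lra.
Qed.

Lemma curve_length_affine (l b : C) (sigma : R) (c : R -> C) :
  csmooth c -> sigma * sigma = 1 ->
  curve_length (fun x => l * cflip sigma (c x) + b)%C = Cmod l * curve_length c.
Proof.
  intros Hc Hs.
  change (prim (fun x => Cmod (Dtheta (fun x => l * cflip sigma (c x) + b)%C x)) (2 * PI)
    = Cmod l * prim (fun x => Cmod (Dtheta c x)) (2 * PI)).
  rewrite (prim_lin (fun x => Cmod (Dtheta c x)) (fun x => Cmod (Dtheta c x)) _ (Cmod l) 0).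
  - ring.
  - intros; now apply Cmod_Dtheta_continuous.
  - intros; now apply Cmod_Dtheta_continuous.
  - intros y. rewrite Dtheta_affine by assumption.
    rewrite Cmod_mult, Cmod_cflip by assumption. ring.
Qed.

Lemma curve_length_pos (p : parity) (c : R -> C) : Imm p c -> 0 < curve_length c.
Proof.
  intros (Hc & _ & N & _). apply RInt_gt_0.
  - pose proof PI_RGT_0; lra.
  - intros. apply Cmod_gt_0, N.
  - intros; now apply Cmod_Dtheta_continuous.
Qed.

Lemma Imm_scale_translate (p : parity) (l : R) (b : C) (c : R -> C) :
  0 < l -> Imm p c -> Imm p (fun x => RtoC l * (c x + b))%C.
Proof.
  intros Hl (Hs & Hp & N & k & Hk & Hpar).
  assert (E : (fun x => RtoC l * (c x + b))%C =
    (fun x => RtoC l * cflip 1 (c x) + RtoC l * b)%C).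
  { apply functional_extensionality; intros x. unfold cflip.
    rewrite Rmult_1_l, <- surjective_pairing. ring. }
  assert (D : forall x, Dtheta (fun x => RtoC l * (c x + b))%C x =
    (l * fst (Dtheta c x), l * snd (Dtheta c x))).
  { intros x. rewrite E, Dtheta_affine by exact Hs.
    unfold cflip, Cmult, RtoC; simpl. f_equal; ring. }
  assert (N' : forall x, Dtheta (fun x => RtoC l * (c x + b))%C x <> 0%C).
  { intros x Z. apply (N x). rewrite D in Z.
    assert (Z1 := f_equal fst Z). assert (Z2 := f_equal snd Z). simpl in Z1, Z2.
    apply injective_projections; simpl; nra. }
  split; [rewrite E; now apply affine_smooth|].
  split; [intros x; now rewrite Hp|]. split; [exact N'|].
  exists k. split; [|exact Hpar].
  apply (proj2 (winding_number_argd _ k N')).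
  apply (proj1 (winding_number_argd c k N)) in Hk. rewrite <- Hk.
  (* The derivative of the argument is homogeneous of degree 0 in the curve, so the factor [l]
     cancels. *)
  apply prim_ext. intros x. unfold argd.
  destruct (smooth_Derive _ (proj1 Hs)) as [S1 _], (smooth_Derive _ (proj2 Hs)) as [S2 _].
  replace (fun x => fst (Dtheta (fun x => RtoC l * (c x + b))%C x))
    with (fun x => l * fst (Dtheta c x))
    by (apply functional_extensionality; intros; now rewrite D).
  replace (fun x => snd (Dtheta (fun x => RtoC l * (c x + b))%C x))
    with (fun x => l * snd (Dtheta c x))
    by (apply functional_extensionality; intros; now rewrite D).
  rewrite !Derive_scal. rewrite D. simpl fst. simpl snd.
  assert (Q := proj1 (Dtheta_neq0 c x) (N x)).
  set (u := fst (Dtheta c x)) in *. set (v := snd (Dtheta c x)) in *.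
  assert (Q' : l * u * (l * u) + l * v * (l * v) <> 0).
  { replace (l * u * (l * u) + l * v * (l * v)) with (l * l * (u * u + v * v)) by ring.
    repeat apply Rmult_integral_contrapositive_currified; lra. }
  field. split; [exact Q|exact Q'].
Qed.

Lemma ImmSim_normalized (r : bool) (p : parity) (A : ImmSim r p) :
  exists c, normalized p c /\ proj1_sig A c.
Proof.
  destruct A as [A (c & Hc & ->)]. simpl.
  assert (P := curve_length_pos p c Hc).
  assert (Pi := Rinv_0_lt_compat _ P).
  set (l := / curve_length c) in *.
  assert (H := Imm_scale_translate p l (- c 0)%C c Pi Hc).
  exists (fun x => RtoC l * (c x + - c 0))%C. split; [|split; [exact H|]].
  - split; [exact H|]. split.
    + rewrite Cplus_opp_r. ring.
    + replace (fun x => RtoC l * (c x + - c 0))%C with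
        (fun x => RtoC l * cflip 1 (c x) + RtoC l * - c 0)%C.
      * rewrite curve_length_affine by (apply Hc || ring).
        rewrite Cmod_R, Rabs_pos_eq by lra. unfold l. field. lra.
      * apply functional_extensionality; intros x. unfold cflip.
        rewrite Rmult_1_l, <- surjective_pairing. ring.
  - exists (fun z => RtoC l * (z + - c 0))%C. split; [|reflexivity].
    apply (sim_comp r (fun z => RtoC l * z)%C (fun z => z + - c 0)%C);
      now constructor.
Qed.

(** * Orthogonal maps and frame changes *)

(** Parametrized by the angle of the frame: the curve is quadratic in [w] and turns by [2 * phi]. *)
Definition orth (phi sigma : R) (z : C) : C := (expi (2 * phi) * cflip sigma z)%C.

Lemma orthogonal_map_orth (r : bool) (phi sigma : R) :
  sign_ok r sigma -> orthogonal_map r (orth phi sigma).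
Proof.
  intros [-> | [-> ->]].
  - replace (orth phi 1) with (fun z => expi (2 * phi) * z)%C; [constructor|].
    apply functional_extensionality; intros [x y].
    unfold orth, cflip; simpl. now rewrite Rmult_1_l.
  - replace (orth phi (-1)) with (fun z => expi (2 * phi) * Cconj z)%C;
      [now constructor|].
    apply functional_extensionality; intros [x y].
    unfold orth, cflip, Cconj; simpl. do 2 f_equal. ring.
Qed.

Lemma orthogonal_map_inv (r : bool) (L : C -> C) : orthogonal_map r L ->
  exists phi sigma, sign_ok r sigma /\ L = orth phi sigma.
Proof.
  intros [a|a Hr].
  - exists (/ 2 * a), 1. split; [now left|].
    apply functional_extensionality; intros [x y].
    unfold orth, cflip; simpl. rewrite Rmult_1_l.
    replace (2 * (/ 2 * a)) with a by field. reflexivity.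
  - exists (/ 2 * a), (-1). split; [now right|].
    apply functional_extensionality; intros [x y].
    unfold orth, cflip, Cconj; simpl.
    replace (2 * (/ 2 * a)) with a by field. do 2 f_equal. ring.
Qed.

Lemma orth_similitude (r : bool) (phi sigma : R) :
  sign_ok r sigma -> similitude r (orth phi sigma).
Proof.
  intros H. destruct (orthogonal_map_orth r phi sigma H) as [a|a Hr].
  - constructor.
  - apply (sim_comp r (fun z => expi a * z)%C Cconj); now constructor.
Qed.

Lemma wint_lin (e f u v u' v' : R -> R) (a b : R) :
  smooth e -> smooth f -> smooth u -> smooth v -> smooth u' -> smooth v' ->
  wint e f (lincomb a u b u') (lincomb a v b v') =
  (fun x => RtoC a * wint e f u v x + RtoC b * wint e f u' v' x)%C.
Proof.
  intros. apply functional_extensionality; intros x.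
  unfold wint, Cmult, Cplus, RtoC; simpl. f_equal.
  - rewrite (prim_lin (fun y => e y * u y - f y * v y)
      (fun y => e y * u' y - f y * v' y) _ a b);
      try (intros; apply smooth_continuous; smooth_tac); [ring|].
    intros; unfold lincomb; ring.
  - rewrite (prim_lin (fun y => e y * v y + f y * u y)
      (fun y => e y * v' y + f y * u' y) _ a b);
      try (intros; apply smooth_continuous; smooth_tac); [ring|].
    intros; unfold lincomb; ring.
Qed.

(** Both factors of the integrand [(e + i f) (u + i v)] are multiplied by [exp (i phi)], after
    conjugation if [sigma = -1]. *)
Lemma wint_turn (phi sigma : R) (e f u v : R -> R) : sigma * sigma = 1 ->
  smooth e -> smooth f -> smooth u -> smooth v ->
  wint (turn1 phi sigma e f) (turn2 phi sigma e f)
    (turn1 phi sigma u v) (turn2 phi sigma u v) =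
  (fun x => orth phi sigma (wint e f u v x)).
Proof.
  intros Hs He Hf Hu Hv. apply functional_extensionality; intros x.
  unfold wint, orth, cflip, expi, Cmult; simpl. rewrite cos_2a, sin_2a.
  f_equal.
  - rewrite (prim_lin (fun y => e y * u y - f y * v y)
      (fun y => e y * v y + f y * u y) _ (cos phi * cos phi - sin phi * sin phi)
      (- (2 * sin phi * cos phi) * sigma));
      try (intros; apply smooth_continuous; smooth_tac); [ring|].
    intros y. unfold turn1, turn2, lincomb.
    transitivity (cos phi * cos phi * (e y * u y - sigma * sigma * (f y * v y))
      - sin phi * sin phi * (e y * u y - sigma * sigma * (f y * v y))
      - 2 * sin phi * cos phi * sigma * (e y * v y + f y * u y)); [ring|].
    rewrite Hs. ring.
  - rewrite (prim_lin (fun y => e y * u y - f y * v y)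
      (fun y => e y * v y + f y * u y) _ (2 * sin phi * cos phi)
      ((cos phi * cos phi - sin phi * sin phi) * sigma));
      try (intros; apply smooth_continuous; smooth_tac); [ring|].
    intros y. unfold turn1, turn2, lincomb.
    transitivity (2 * sin phi * cos phi * (e y * u y - sigma * sigma * (f y * v y))
      + (cos phi * cos phi - sin phi * sin phi) * sigma * (e y * v y + f y * u y));
      [ring|].
    rewrite Hs. ring.
Qed.

Lemma basic_curve_turn (phi sigma : R) (e f : R -> R) : sigma * sigma = 1 ->
  smooth e -> smooth f ->
  basic_curve (turn1 phi sigma e f) (turn2 phi sigma e f) =
  (fun x => orth phi sigma (basic_curve e f x)).
Proof.
  intros Hs He Hf. rewrite !basic_curve_wint by (assumption || now apply smooth_lincomb).
  rewrite <- wint_turn by (assumption || now apply smooth_half).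
  f_equal; apply functional_extensionality; intros x;
    unfold half, turn1, turn2, lincomb; ring.
Qed.

(* The curves determine [e + i f] up to sign, and conjugation if [r = true]. *)
Lemma similar_curves_plane_eq (r : bool) (p : parity) (W W' : plane)
    (e f e' f' : R -> R) (g : C -> C) :
  basis r p W e f -> basis r p W' e' f' ->
  orthonormal e f -> orthonormal e' f' ->
  (forall x, e x * e x + f x * f x <> 0) ->
  similitude r g -> basic_curve e' f' = (fun x => g (basic_curve e f x)) ->
  W = W'.
Proof.
  intros HW HW' (O1 & O2 & O3) (O1' & O2' & O3') Hn Hg E.
  assert (He : smooth e) by apply HW. assert (Hf : smooth f) by apply HW.
  assert (He' : smooth e') by apply HW'. assert (Hf' : smooth f') by apply HW'.
  destruct (similitude_affine r g Hg) as (l & b & sigma & Hs & Eg).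
  assert (E' : basic_curve e' f' = (fun x => l * cflip sigma (basic_curve e f x) + b)%C).
  { rewrite E. apply functional_extensionality; intros; apply Eg. }
  assert (Q := sign_ok_sqr r sigma Hs).
  assert (Sc : csmooth (basic_curve e f)).
  { rewrite basic_curve_wint by assumption. apply wint_smooth; auto using smooth_half. }
  (* Both curves have length 1, which excludes a genuine scaling. *)
  assert (Hl : Cmod l = 1).
  { assert (X := f_equal curve_length E').
    rewrite curve_length_affine, !length_basic_curve, O1, O2, O1', O2' in X
      by assumption. lra. }
  assert (Hl2 : fst l * fst l + snd l * snd l = 1).
  { unfold Cmod in Hl. rewrite <- (Rmult_1_l 1). rewrite <- Hl at 1.
    rewrite <- Hl at 1. rewrite sqrt_sqrt; [simpl; ring|].
    pose proof (pow2_ge_0 (fst l)). pose proof (pow2_ge_0 (snd l)). lra. }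
  destruct (unit_angle _ _ Hl2) as (t & Et1 & Et2).
  (* Turning the frame by half the angle of [l] reproduces the rotation of the curve. *)
  set (phi := / 2 * t).
  assert (El : l = expi (2 * phi)).
  { apply injective_projections; unfold phi, expi; simpl;
      replace (2 * (/ 2 * t)) with t by field; assumption. }
  set (e1 := turn1 phi sigma e f). set (f1 := turn2 phi sigma e f).
  assert (S1 : smooth e1) by now apply smooth_lincomb.
  assert (S2 : smooth f1) by now apply smooth_lincomb.
  assert (Hfr : orthonormal_frame W e1 f1).
  { apply (turn_orthonormal_frame r p); auto.
    - now exists e, f.
    - split; [now apply basis_frames with r p|now split]. }
  assert (HW1 : basis r p W e1 f1)
    by (apply basis_change with e f; [exact HW|apply Hfr]).
  (* Comparing derivatives discards the translation [b]. *)
  assert (D : forall x, Dtheta (basic_curve e1 f1) x = Dtheta (basic_curve e' f') x).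
  { intros x. unfold e1, f1. rewrite basic_curve_turn by assumption.
    rewrite E', Dtheta_affine, El by assumption.
    replace (fun x => orth phi sigma (basic_curve e f x)) with
      (fun x => expi (2 * phi) * cflip sigma (basic_curve e f x) + 0)%C.
    - now rewrite Dtheta_affine.
    - apply functional_extensionality; intros y. unfold orth. ring. }
  assert (D' : forall x, e1 x * e1 x - f1 x * f1 x = e' x * e' x - f' x * f' x /\
     e1 x * f1 x = e' x * f' x).
  { intros x. specialize (D x).
    rewrite !basic_curve_wint, !Dtheta_wint in D by auto using smooth_half.
    unfold half in D. injection D as D1 D2. lra. }
  destruct (sqrt_sign e1 f1 e' f') as (s & Hsg & Es); auto.
  - apply (basis_nonzero r p W e1 f1 HW1), (basis_nonzero r p W e f HW), Hn.
  - intros; apply D'.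
  - intros; apply D'.
  - apply basis_plane_eq with r p e' f'; [|exact HW'].
    apply basis_change with e1 f1; [exact HW1|].
    destruct HW1 as (_ & _ & _ & _ & Hb). apply Hb. exists s, 0, 0, s.
    split; [|split].
    + apply functional_extensionality; intros x. destruct (Es x) as [-> _].
      unfold lincomb; ring.
    + apply functional_extensionality; intros x. destruct (Es x) as [_ ->].
      unfold lincomb; ring.
    (* The same sign multiplies both vectors, so the determinant is [s^2 = 1] and an orientation is
       kept. *)
    + replace (s * s - 0 * 0) with 1 by (destruct Hsg as [-> | ->]; ring).
      apply admissible_det_1.
Qed.

(** * The map on points *)

Lemma Gr0_frame (r : bool) (p : parity) (W : Gr0 r p) (e f : R -> R) :
  orthonormal_frame (proj1_sig W) e f ->
  basis r p (proj1_sig W) e f /\ forall x, e x * e x + f x * f x <> 0.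
Proof.
  intros [Hfr _]. destruct W as [W [HW H0]]. simpl in *.
  assert (B := plane_basis r p W e f HW Hfr). split; [exact B|].
  now apply (basis_nonzero r p W e f B).
Qed.

Lemma Gr0_frame_normalized (r : bool) (p : parity) (W : Gr0 r p) (e f : R -> R) :
  orthonormal_frame (proj1_sig W) e f -> normalized p (basic_curve e f).
Proof.
  intros H. destruct (Gr0_frame r p W e f H) as [B Hn].
  apply basic_curve_normalized; [apply B|apply B|apply H|exact Hn].
Qed.

(** A non-canonical choice, made only to define [Phi] as a function; [Phi_induced] shows that every
    other frame yields a curve of the same class. *)
Definition frame_choice (r : bool) (p : parity) (W : Gr0 r p) :
  {ef : (R -> R) * (R -> R) | orthonormal_frame (proj1_sig W) (fst ef) (snd ef)}.
Proof.
  apply constructive_indefinite_description.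
  destruct (orthonormal_frame_exists r p (proj1_sig W) (proj1 (proj2_sig W)))
    as (e & f & H).
  now exists (e, f).
Defined.

Definition frame1 (r : bool) (p : parity) (W : Gr0 r p) : R -> R :=
  fst (proj1_sig (frame_choice r p W)).
Definition frame2 (r : bool) (p : parity) (W : Gr0 r p) : R -> R :=
  snd (proj1_sig (frame_choice r p W)).

Lemma frame12 (r : bool) (p : parity) (W : Gr0 r p) :
  orthonormal_frame (proj1_sig W) (frame1 r p W) (frame2 r p W).
Proof. exact (proj2_sig (frame_choice r p W)). Qed.

Definition Phi (r : bool) (p : parity) (W : Gr0 r p) : ImmSim r p :=
  exist _ (sim_class r p (basic_curve (frame1 r p W) (frame2 r p W)))
    (ex_intro _ _ (conj
       (proj1 (Gr0_frame_normalized r p W _ _ (frame12 r p W))) eq_refl)).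

Lemma Phi_induced (r : bool) (p : parity) : induced_by_basic_curve r p (Phi r p).
Proof.
  intros W e f H. split; [apply (Gr0_frame_normalized r p W e f H)|].
  destruct (orthonormal_frame_turn r p (proj1_sig W) _ _ e f
    (proj1 (proj2_sig W)) (frame12 r p W) H) as (phi & sigma & Hs & -> & ->).
  destruct (Gr0_frame r p W _ _ (frame12 r p W)) as [B _].
  exists (orth phi sigma). split; [now apply orth_similitude|].
  apply basic_curve_turn; [now apply sign_ok_sqr with r|apply B|apply B].
Qed.

Lemma Phi_injective (r : bool) (p : parity) (W W' : Gr0 r p) :
  Phi r p W = Phi r p W' -> W = W'.
Proof.
  intros E. apply sig_eq.
  assert (H := Phi_induced r p W' _ _ (frame12 r p W')). rewrite <- E in H.
  destruct H as [_ (g & Hg & Eg)].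
  destruct (Gr0_frame r p W _ _ (frame12 r p W)) as [B Hn].
  destruct (Gr0_frame r p W' _ _ (frame12 r p W')) as [B' _].
  apply (similar_curves_plane_eq r p _ _ _ _ _ _ g B B'); auto; apply frame12.
Qed.

Lemma Gr0_of_frame (r : bool) (p : parity) (e f : R -> R) :
  inV p e -> inV p f -> orthonormal e f ->
  (forall x, e x * e x + f x * f x <> 0) ->
  exists W : Gr0 r p, orthonormal_frame (proj1_sig W) e f.
Proof.
  intros He Hf Ho Hn.
  assert (B := span_plane_basis r p e f He Hf Ho).
  assert (HW : is_plane r p (span_plane r e f) /\ no_common_zero (span_plane r e f)).
  { split; [now exists e, f|]. now apply (basis_nonzero r p _ e f B). }
  exists (exist _ (span_plane r e f) HW). split; [exact (basis_frames r p _ e f B)|exact Ho].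
Qed.

(** The frames are smooth in [s], the planes are only found pointwise; injectivity of [Phi] later
    identifies them with the values of the inverse map. *)
Lemma Phi_lift (r : bool) (p : parity) (A : R -> ImmSim r p) (c : R -> R -> C) :
  normalized_lift r p A c ->
  exists e f, smooth2 e /\ smooth2 f /\ forall s, exists W : Gr0 r p,
    orthonormal_frame (proj1_sig W) (e s) (f s) /\ Phi r p W = A s.
Proof.
  intros [Hc Hs].
  destruct (sqrt_lift p c Hc) as (e & f & He & Hf & H); [intros s; apply Hs|].
  exists e, f. split; [exact He|]. split; [exact Hf|]. intros s.
  destruct (H s) as (Ve & Vf & Ho & Hn & Ec).
  destruct (Gr0_of_frame r p (e s) (f s) Ve Vf Ho Hn) as (W & HW).
  exists W. split; [exact HW|]. apply (ImmSim_eq r p _ _ (c s)).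
  - rewrite <- Ec. now apply Phi_induced.
  - apply Hs.
Qed.

Lemma Phi_surjective (r : bool) (p : parity) (A : ImmSim r p) :
  exists W, Phi r p W = A.
Proof.
  destruct (ImmSim_normalized r p A) as (c & Hc & HA).
  (* A single class is lifted as a constant family. *)
  destruct (Phi_lift r p (fun _ => A) (fun _ => c)) as (e & f & _ & _ & H).
  - split; [|now intros]. destruct Hc as [[[S1 S2] _] _].
    split; [exact (smooth_smooth2 _ S1)|exact (smooth_smooth2 _ S2)].
  - destruct (H 0) as (W & _ & E). now exists W.
Qed.

Lemma basic_curve_csmooth2 (e f : R -> R -> R) : smooth2 e -> smooth2 f ->
  csmooth2 (fun s => basic_curve (e s) (f s)).
Proof.
  intros He Hf.
  assert (E : (fun s => basic_curve (e s) (f s)) =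
    fun s => wint (e s) (f s) (half (e s)) (half (f s))).
  { apply functional_extensionality; intros s.
    apply basic_curve_wint; now apply smooth2_smooth. }
  rewrite E.
  assert (He' : smooth2 (fun s => half (e s)))
    by (apply (smooth2_mult (fun _ _ => / 2)); auto using smooth2_const).
  assert (Hf' : smooth2 (fun s => half (f s)))
    by (apply (smooth2_mult (fun _ _ => / 2)); auto using smooth2_const).
  split.
  - apply (smooth2_prim (fun s y => e s y * half (e s) y - f s y * half (f s) y)).
    apply smooth2_minus; now apply smooth2_mult.
  - apply (smooth2_prim (fun s y => e s y * half (f s) y + f s y * half (e s) y)).
    apply smooth2_plus; now apply smooth2_mult.
Qed.

Lemma frame_lift_normalized_lift (r : bool) (p : parity) (g : R -> Gr0 r p)
    (e f : R -> R -> R) :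
  frame_lift r p g e f ->
  normalized_lift r p (fun s => Phi r p (g s)) (fun s => basic_curve (e s) (f s)).
Proof.
  intros (He & Hf & H). split; [now apply basic_curve_csmooth2|].
  intros s. split.
  - exact (Gr0_frame_normalized r p (g s) _ _ (H s)).
  - now apply Phi_induced.
Qed.

Lemma Phi_diffeomorphism (r : bool) (p : parity) :
  diffeomorphism (rescale 2 (GrassmannR r p)) (ImmSimR r p) (Phi r p).
Proof.
  split.
  - intros g (e & f & H). eexists. now apply (frame_lift_normalized_lift r p g e f).
  - exists (fun A => proj1_sig (constructive_indefinite_description _
      (Phi_surjective r p A))).
    set (Psi := fun A => proj1_sig (constructive_indefinite_description _
      (Phi_surjective r p A))).
    assert (H1 : forall A, Phi r p (Psi A) = A)
      by (intros A; apply (proj2_sig (constructive_indefinite_description _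
        (Phi_surjective r p A)))).
    assert (H2 : forall W, Psi (Phi r p W) = W)
      by (intros W; apply Phi_injective, H1).
    split; [|split; [exact H2|exact H1]].
    intros A (c & Hc). destruct (Phi_lift r p A c Hc) as (e & f & He & Hf & H).
    exists e, f. split; [exact He|]. split; [exact Hf|]. intros s.
    destruct (H s) as (W & HW & <-).
    change (orthonormal_frame (proj1_sig (Psi (Phi r p W))) (e s) (f s)).
    now rewrite H2.
Qed.

(** * The tangent map *)

Lemma sin2_cos2_mult (a : R) : sin a * sin a + cos a * cos a = 1.
Proof. exact (sin2_cos2 a). Qed.

Lemma Cmod_orth (phi sigma : R) (z : C) :
  sigma * sigma = 1 -> Cmod (orth phi sigma z) = Cmod z.
Proof.
  intros H. unfold orth. rewrite Cmod_mult, Cmod_cflip by exact H.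
  unfold expi. rewrite (Cmod_sum_sqr _ _ 1); [ring|lra|].
  pose proof (sin2_cos2_mult (2 * phi)); lra.
Qed.

Lemma Dtheta_orth (phi sigma : R) (c : R -> C) (x : R) : csmooth c ->
  Dtheta (fun x => orth phi sigma (c x)) x = orth phi sigma (Dtheta c x).
Proof.
  intros Hc. unfold orth. rewrite <- (Dtheta_affine _ 0%C) by exact Hc.
  replace (fun y => expi (2 * phi) * cflip sigma (c y) + 0)%C with
    (fun y => expi (2 * phi) * cflip sigma (c y))%C; [reflexivity|].
  apply functional_extensionality; intros; ring.
Qed.

(** The common factor [k] stands for the inverse of [|c'|] in [Ds], once the division is
    unfolded. *)
Lemma orth_dot (phi sigma : R) (z w k : C) : sigma * sigma = 1 ->
  Re (orth phi sigma z * k * Cconj (orth phi sigma w * k))%C =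
  Re (z * k * Cconj (w * k))%C.
Proof.
  intros Hs. destruct z as [z1 z2], w as [w1 w2], k as [k1 k2].
  unfold orth, cflip, expi, Cconj, Cmult, Re; simpl.
  pose proof (sin2_cos2_mult (2 * phi)) as T.
  set (S := sin (2 * phi)) in *. set (K := cos (2 * phi)) in *.
  transitivity ((S * S + K * K) * (k1 * k1 + k2 * k2) *
    (z1 * w1 + sigma * sigma * (z2 * w2))); [ring|].
  rewrite T, Hs. ring.
Qed.

Lemma G_orth (phi sigma : R) (c h k : R -> C) : sigma * sigma = 1 ->
  csmooth c -> csmooth h -> csmooth k ->
  G (fun x => orth phi sigma (c x)) (fun x => orth phi sigma (h x))
    (fun x => orth phi sigma (k x)) = G c h k.
Proof.
  intros Hs Hc Hh Hk. unfold G. f_equal.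
  - f_equal. apply (RInt_ext (V := R_CompleteNormedModule)). intros x _.
    now rewrite Dtheta_orth, Cmod_orth.
  - apply (RInt_ext (V := R_CompleteNormedModule)). intros x _. unfold Ds.
    rewrite !Dtheta_orth, Cmod_orth by assumption.
    unfold Cdiv. now rewrite orth_dot.
Qed.

(** Conjugation reverses the direction of rotation, hence the factor [sigma]. *)
Lemma rot_dir_orth (phi sigma : R) (c : R -> C) : sigma * sigma = 1 ->
  rot_dir (fun x => orth phi sigma (c x)) =
  (fun x => orth phi sigma (RtoC sigma * rot_dir c x)%C).
Proof.
  intros Hs. apply functional_extensionality; intros x. unfold rot_dir, orth.
  destruct (c x) as [a b]. unfold cflip, expi, Ci, RtoC, Cmult; simpl.
  f_equal.
  - transitivity (- (sigma * b) * cos (2 * phi) - sigma * sigma * a * sin (2 * phi));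
      [rewrite Hs; ring|ring].
  - transitivity (- (sigma * b) * sin (2 * phi) + sigma * sigma * a * cos (2 * phi));
      [rewrite Hs; ring|ring].
Qed.

(** [i c' = w (i w / 2)]: rotating the curve is the variation [dw = i w / 2] of the frame. *)
Lemma rot_dir_basic_curve (e f : R -> R) : smooth e -> smooth f ->
  rot_dir (basic_curve e f) =
  wint e f (lincomb 0 e (- / 2) f) (lincomb (/ 2) e 0 f).
Proof.
  intros He Hf. rewrite basic_curve_wint by assumption.
  apply functional_extensionality; intros x. unfold rot_dir, wint, Ci, Cmult; simpl.
  f_equal.
  - rewrite (prim_lin (fun y => e y * half f y + f y * half e y)
      (fun y => e y * half f y + f y * half e y)
      (fun y => e y * lincomb 0 e (- / 2) f y - f y * lincomb (/ 2) e 0 f y) (-1) 0);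
      try (intros; apply smooth_continuous; smooth_tac); [ring|].
    intros; unfold lincomb, half; ring.
  - rewrite (prim_lin (fun y => e y * half e y - f y * half f y)
      (fun y => e y * half e y - f y * half f y)
      (fun y => e y * lincomb (/ 2) e 0 f y + f y * lincomb 0 e (- / 2) f y) 1 0);
      try (intros; apply smooth_continuous; smooth_tac); [ring|].
    intros; unfold lincomb, half; ring.
Qed.

Lemma basic_curve_csmooth (e f : R -> R) : smooth e -> smooth f ->
  csmooth (basic_curve e f).
Proof.
  intros He Hf. rewrite basic_curve_wint by assumption.
  apply wint_smooth; auto using smooth_half.
Qed.

(* The pairs [(c, h)] below are those of [tangent_class (basic_curve e f) (wint e f u v)];
   only [a = 0] gives a horizontal one. *)
Lemma G_tangent_class (a phi sigma : R) (e f u v : R -> R) :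
  smooth e -> smooth f -> smooth u -> smooth v -> orthonormal e f ->
  (forall x, e x * e x + f x * f x <> 0) -> sigma * sigma = 1 ->
  inner u e = 0 -> inner u f = 0 -> inner v e = 0 -> inner v f = 0 ->
  let c := fun x => orth phi sigma (basic_curve e f x) in
  let h := fun x => orth phi sigma
    (wint e f u v x + RtoC a * rot_dir (basic_curve e f) x)%C in
  G c h (rot_dir c) = sigma * a /\
  G c h h = 2 * (inner u u + inner v v) + a * a.
Proof.
  intros He Hf Hu Hv Ho Hn Hs Hue Huf Hve Hvf c h.
  destruct Ho as (O1 & O2 & O3). assert (Ho : orthonormal e f) by now split.
  set (i1 := lincomb 0 e (- / 2) f). set (i2 := lincomb (/ 2) e 0 f).
  assert (S1 : smooth i1) by now apply smooth_lincomb.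
  assert (S2 : smooth i2) by now apply smooth_lincomb.
  assert (Sc := basic_curve_csmooth e f He Hf).
  assert (Eh : h = fun x => orth phi sigma
     (wint e f (lincomb 1 u a i1) (lincomb 1 v a i2) x)).
  { unfold h. rewrite wint_lin, rot_dir_basic_curve by assumption.
    apply functional_extensionality; intros x. f_equal. fold i1 i2. ring. }
  assert (Er : rot_dir c = fun x => orth phi sigma
     (wint e f (lincomb 0 u sigma i1) (lincomb 0 v sigma i2) x)).
  { unfold c. rewrite rot_dir_orth, wint_lin, rot_dir_basic_curve by assumption.
    apply functional_extensionality; intros x. f_equal. fold i1 i2. ring. }
  (* [i1 + i i2 = i w / 2] has squared norm 1/2, so the rotation direction has norm 1 for [G]; it is
     orthogonal to the variation because [u] and [v] are orthogonal to [e] and [f]. *)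
  assert (Q : inner u i1 = 0 /\ inner v i2 = 0 /\ inner i1 i1 = / 4 /\ inner i2 i2 = / 4).
  { unfold i1, i2. repeat split; rewrite ?inner_lincomb_r, ?inner_lincomb_l by smooth_tac;
      rewrite ?(inner_lincomb_r _ _ e f) by smooth_tac;
      rewrite ?(inner_sym f e), ?O1, ?O2, ?O3, ?Hue, ?Huf, ?Hve, ?Hvf; lra. }
  destruct Q as (Q1 & Q2 & Q3 & Q4).
  rewrite Er, Eh. unfold c.
  assert (Sh : csmooth (wint e f (lincomb 1 u a i1) (lincomb 1 v a i2)))
    by (apply wint_smooth; smooth_tac).
  assert (Sr : csmooth (wint e f (lincomb 0 u sigma i1) (lincomb 0 v sigma i2)))
    by (apply wint_smooth; smooth_tac).
  rewrite (G_orth phi sigma _ _ _ Hs Sc Sh Sr), (G_orth phi sigma _ _ _ Hs Sc Sh Sh).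
  rewrite !G_wint by smooth_tac.
  rewrite !(inner_lincomb_l _ _ u i1), !(inner_lincomb_l _ _ v i2) by smooth_tac.
  rewrite !inner_lincomb_r by smooth_tac.
  rewrite (inner_sym i1 u), (inner_sym i2 v), Q1, Q2, Q3, Q4.
  split; lra.
Qed.

Lemma basis_carrier (r : bool) (p : parity) (W : plane) (e f : R -> R) :
  basis r p W e f -> carrier W e /\ carrier W f.
Proof.
  intros (_ & _ & _ & Hc & _). split; apply Hc.
  - exists 1, 0. now rewrite lincomb_10.
  - exists 0, 1. now rewrite lincomb_01.
Qed.

Lemma frame1_carrier (r : bool) (p : parity) (W : Gr0 r p) :
  carrier (proj1_sig W) (frame1 r p W).
Proof.
  destruct (Gr0_frame r p W _ _ (frame12 r p W)) as [B _].
  now apply basis_carrier in B.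
Qed.

Lemma frame2_carrier (r : bool) (p : parity) (W : Gr0 r p) :
  carrier (proj1_sig W) (frame2 r p W).
Proof.
  destruct (Gr0_frame r p W _ _ (frame12 r p W)) as [B _].
  now apply basis_carrier in B.
Qed.

(** The differential of [basic_curve] at [(e, f)] in the direction [(y e, y f)], since half the
    integral of [w^2] varies by the integral of [w dw]. *)
Definition variation (p : parity) (W : plane) (e f : {u | carrier W u})
    (y : hom_perp p W) : R -> C :=
  wint (proj1_sig e) (proj1_sig f) (y e) (y f).

Lemma hom_perp_smooth (p : parity) (W : plane) (y : hom_perp p W) u : smooth (y u).
Proof. apply (hom_inV p W y u). Qed.

(** The images of [y] are orthogonal to the plane. This closes up the variation, and it also fixes
    the length: the curve itself corresponds to [dw = w / 2], which is orthogonal to them. *)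
Lemma variation_slice_tangent (r : bool) (p : parity) (W : Gr0 r p)
    (e f : {u | carrier (proj1_sig W) u}) (y : hom_perp p (proj1_sig W)) :
  orthonormal_frame (proj1_sig W) (proj1_sig e) (proj1_sig f) ->
  slice_tangent (basic_curve (proj1_sig e) (proj1_sig f))
    (variation p (proj1_sig W) e f y).
Proof.
  intros H. destruct (Gr0_frame r p W _ _ H) as [B Hn].
  assert (Ve : inV p (proj1_sig e)) by apply B.
  assert (Vf : inV p (proj1_sig f)) by apply B.
  assert (Se : smooth (proj1_sig e)) by apply Ve.
  assert (Sf : smooth (proj1_sig f)) by apply Vf.
  assert (Su := hom_perp_smooth p _ y e). assert (Sv := hom_perp_smooth p _ y f).
  assert (P : forall u w, inner (y u) (proj1_sig w) = 0)
    by (intros u w; apply hom_perpP; exact (proj2_sig w)).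
  split; [now apply wint_smooth|]. split; [|split].
  - apply wint_periodic with p; auto using hom_inV;
      rewrite (inner_sym (proj1_sig e)), (inner_sym (proj1_sig f)), !P; ring.
  - apply wint_0.
  - unfold variation. rewrite (basic_curve_wint (proj1_sig e)) at 2 by assumption.
    rewrite G_wint by (smooth_tac; apply H).
    rewrite !inner_half, !P by assumption. ring.
Qed.

(** Taken at the chosen frame; the class absorbs both another choice of frame and an infinitesimal
    rotation of a lifted one. *)
Definition TPhi (r : bool) (p : parity) (W : Gr0 r p)
    (y : hom_perp p (proj1_sig W)) : ImmSim_tangent r p (Phi r p W) :=
  exist _ (tangent_class r (basic_curve (frame1 r p W) (frame2 r p W))
     (variation p (proj1_sig W) (exist _ _ (frame1_carrier r p W))
        (exist _ _ (frame2_carrier r p W)) y))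
    (ex_intro _ _ (ex_intro _ _
      (conj (Phi_induced r p W _ _ (frame12 r p W))
      (conj (Gr0_frame_normalized r p W _ _ (frame12 r p W))
      (conj (variation_slice_tangent r p W (exist _ _ (frame1_carrier r p W))
        (exist _ _ (frame2_carrier r p W)) y (frame12 r p W)) eq_refl))))).

Lemma hom_normsq_frame (p : parity) (r : bool) (W : Gr0 r p)
    (y : hom_perp p (proj1_sig W)) (e0 f0 e f : {u | carrier (proj1_sig W) u}) :
  orthonormal_frame (proj1_sig W) (proj1_sig e0) (proj1_sig f0) ->
  orthonormal (proj1_sig e) (proj1_sig f) ->
  inner (y e) (y e) + inner (y f) (y f) =
  inner (y e0) (y e0) + inner (y f0) (y f0).
Proof.
  intros H Ho. destruct (Gr0_frame r p W _ _ H) as [B _].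
  destruct B as (Ve & Vf & _ & Hc & _).
  destruct (proj1 (Hc (proj1_sig e)) (proj2_sig e)) as (a & b & Ee).
  destruct (proj1 (Hc (proj1_sig f)) (proj2_sig f)) as (a' & b' & Ef).
  rewrite Ee, Ef in Ho.
  (* The pair in [hom_normsq] may be negatively oriented, hence [true] whatever [r] is. *)
  destruct (orthonormal_turn true (proj1_sig e0) (proj1_sig f0) a b a' b')
    as (phi & sigma & Hs & E1 & E2);
    [apply Ve|apply Vf|apply H|exact Ho|discriminate|].
  rewrite E1 in Ee. rewrite E2 in Ef.
  rewrite (hom_linear _ _ y _ _ e0 f0 e Ee), (hom_linear _ _ y _ _ e0 f0 f Ef).
  apply turn_inner_sum; auto using hom_perp_smooth.
  now apply sign_ok_sqr with true.
Qed.

Lemma TPhi_normsq (r : bool) (p : parity) (W : Gr0 r p)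
    (y : hom_perp p (proj1_sig W)) (q : R) :
  normsq (rescale 2 (GrassmannR r p)) W y q <->
  normsq (ImmSimR r p) (Phi r p W) (TPhi r p W y) q.
Proof.
  set (e := frame1 r p W). set (f := frame2 r p W).
  set (ye := exist _ _ (frame1_carrier r p W) : {u | carrier (proj1_sig W) u}).
  set (yf := exist _ _ (frame2_carrier r p W) : {u | carrier (proj1_sig W) u}).
  assert (H := frame12 r p W). fold e f in H.
  destruct (Gr0_frame r p W _ _ H) as [B Hn].
  assert (Se : smooth e) by apply B. assert (Sf : smooth f) by apply B.
  assert (Ho : orthonormal e f) by apply H.
  assert (P : forall u w, inner (y u) (proj1_sig w) = 0)
    by (intros u w; apply hom_perpP; exact (proj2_sig w)).
  assert (K : forall a phi sigma, sigma * sigma = 1 ->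
     let c := fun x => orth phi sigma (basic_curve e f x) in
     let h := fun x => orth phi sigma
       (wint e f (y ye) (y yf) x + RtoC a * rot_dir (basic_curve e f) x)%C in
     G c h (rot_dir c) = sigma * a /\
     G c h h = 2 * (inner (y ye) (y ye) + inner (y yf) (y yf)) + a * a).
  { intros a phi sigma Hs.
    apply G_tangent_class; auto using hom_perp_smooth; [apply (P ye ye)|apply (P ye yf)
      |apply (P yf ye)|apply (P yf yf)]. }
  split.
  - intros (q' & (e' & f' & Ho' & Eq') & Eq).
    rewrite (hom_normsq_frame p r W y ye yf e' f') in Eq' by assumption.
    destruct (K 0 0 1) as [K1 K2]; [ring|].
    eexists; eexists. split; [|split; [rewrite K1; ring|rewrite K2, Eq, Eq'; ring]].
    exists (orth 0 1), 0. split; [apply orthogonal_map_orth; now left|].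
    split; reflexivity.
  - intros (c & h & (L & a & HL & Ec & Eh) & Eh0 & Eq).
    destruct (orthogonal_map_inv r L HL) as (phi & sigma & Hs & EL).
    apply sign_ok_sqr in Hs.
    rewrite EL in Ec, Eh. destruct (K a phi sigma Hs) as [K1 K2].
    change (c = fun x => orth phi sigma (basic_curve e f x)) in Ec.
    change (h = fun x => orth phi sigma
       (wint e f (y ye) (y yf) x + RtoC a * rot_dir (basic_curve e f) x)%C) in Eh.
    rewrite <- Ec, <- Eh in K1, K2.
    rewrite K1 in Eh0. rewrite K2 in Eq.
    (* Horizontality reads [sigma * a = 0], and [sigma] squares to 1. *)
    assert (a = 0).
    { rewrite <- (Rmult_1_l a), <- Hs, Rmult_assoc, Eh0. ring. }
    subst a. exists (inner (y ye) (y ye) + inner (y yf) (y yf)).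
    split; [exists ye, yf; now split|]. rewrite Eq. ring.
Qed.

(** * Velocities of lifted frames and of their curves *)

Lemma is_derive_inner (u v : R -> R -> R) (t : R) : smooth2 u -> smooth2 v ->
  is_derive (fun s => inner (u s) (v s)) t
    (inner (pds u t) (v t) + inner (u t) (pds v t)).
Proof.
  intros Hu Hv.
  assert (Huv : smooth2 (fun s x => u s x * v s x)) by now apply smooth2_mult.
  eapply is_derive_value.
  - exact (is_derive_prim_param (fun s x => u s x * v s x) t (2 * PI) Huv).
  - destruct (smooth2_pds u Hu) as [Su Du], (smooth2_pds v Hv) as [Sv Dv].
    rewrite (prim_lin (fun x => pds u t x * v t x) (fun x => u t x * pds v t x)
      _ 1 1).
    + rewrite <- !inner_prim. ring.
    + intros; apply smooth_mult_continuous; now apply smooth2_smooth.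
    + intros; apply smooth_mult_continuous; now apply smooth2_smooth.
    + intros x. unfold pds at 1. apply is_derive_unique. eapply is_derive_value.
      * apply (is_derive_Rmult (fun z => u z x) (fun z => v z x)); auto.
      * ring.
Qed.

Lemma inner_const_derive (k : R) (u v : R -> R -> R) (t : R) :
  smooth2 u -> smooth2 v -> (forall s, inner (u s) (v s) = k) ->
  inner (pds u t) (v t) + inner (u t) (pds v t) = 0.
Proof.
  intros Hu Hv Hk.
  rewrite <- (is_derive_unique _ _ _ (is_derive_inner u v t Hu Hv)).
  apply is_derive_unique. apply (is_derive_ext (fun _ => k)).
  - intros s. now rewrite Hk.
  - exact (is_derive_const k t).
Qed.

(** Differentiation under the integral sign; the product rule applied to [w (w / 2)] gives
    [w dw]. *)
Lemma ctime_derive_basic_curve (e f : R -> R -> R) (t : R) :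
  smooth2 e -> smooth2 f ->
  ctime_derive (fun s => basic_curve (e s) (f s)) t =
  wint (e t) (f t) (time_derive e t) (time_derive f t).
Proof.
  intros He Hf.
  replace (fun s => basic_curve (e s) (f s)) with
    (fun s => wint (e s) (f s) (half (e s)) (half (f s)))
    by (apply functional_extensionality; intros s; symmetry;
        apply basic_curve_wint; now apply smooth2_smooth).
  destruct (smooth2_pds e He) as [Se De], (smooth2_pds f Hf) as [Sf Df].
  assert (He' : smooth2 (fun s => half (e s)))
    by (apply (smooth2_mult (fun _ _ => / 2)); auto using smooth2_const).
  assert (Hf' : smooth2 (fun s => half (f s)))
    by (apply (smooth2_mult (fun _ _ => / 2)); auto using smooth2_const).
  assert (De' : forall s x, is_derive (fun z => half (e z) x) s (/ 2 * pds e s x))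
    by (intros; now apply (is_derive_scal (fun z => e z x))).
  assert (Df' : forall s x, is_derive (fun z => half (f z) x) s (/ 2 * pds f s x))
    by (intros; now apply (is_derive_scal (fun z => f z x))).
  apply functional_extensionality; intros x.
  unfold ctime_derive, wint; simpl. f_equal.
  - apply is_derive_unique. eapply is_derive_value.
    + apply (is_derive_prim_param
        (fun s y => e s y * half (e s) y - f s y * half (f s) y)).
      apply smooth2_minus; now apply smooth2_mult.
    + apply prim_ext. intros y. unfold pds at 1. apply is_derive_unique.
      eapply is_derive_value.
      * apply (is_derive_minus (fun z => e z y * half (e z) y)
          (fun z => f z y * half (f z) y));
          [apply (is_derive_Rmult (fun z => e z y))
          |apply (is_derive_Rmult (fun z => f z y))]; auto.
      * unfold minus, plus, opp, half; simpl.
        change (time_derive e t y) with (pds e t y).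
        change (time_derive f t y) with (pds f t y). field.
  - apply is_derive_unique. eapply is_derive_value.
    + apply (is_derive_prim_param
        (fun s y => e s y * half (f s) y + f s y * half (e s) y)).
      apply smooth2_plus; now apply smooth2_mult.
    + apply prim_ext. intros y. unfold pds at 1. apply is_derive_unique.
      eapply is_derive_value.
      * apply (is_derive_Rplus (fun z => e z y * half (f z) y)
          (fun z => f z y * half (e z) y));
          [apply (is_derive_Rmult (fun z => e z y))
          |apply (is_derive_Rmult (fun z => f z y))]; auto.
      * unfold half.
        change (time_derive e t y) with (pds e t y).
        change (time_derive f t y) with (pds f t y). field.
Qed.

(* Orthonormality forces the [W]-component of [(e', f')] to be skew, i.e. an
   infinitesimal rotation of the frame. *)
Lemma frame_velocity (r : bool) (p : parity) (g : R -> Gr0 r p) (t : R)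
    (y : hom_perp p (proj1_sig (g t))) (e f : R -> R -> R)
    (we wf : {u | carrier (proj1_sig (g t)) u}) :
  frame_lift r p g e f -> proj1_sig we = e t -> proj1_sig wf = f t ->
  carrier (proj1_sig (g t)) (fun x => time_derive e t x - y we x) ->
  carrier (proj1_sig (g t)) (fun x => time_derive f t x - y wf x) ->
  exists b, time_derive e t = (fun x => y we x + b * f t x) /\
    time_derive f t = (fun x => y wf x - b * e t x).
Proof.
  intros (He & Hf & H) Ewe Ewf Hue Huf.
  destruct (Gr0_frame r p (g t) _ _ (H t)) as [(Ve & Vf & _ & Hc & _) _].
  destruct (H t) as [_ (O1 & O2 & O3)].
  assert (Se : smooth (e t)) by apply Ve. assert (Sf : smooth (f t)) by apply Vf.
  assert (P : forall u, inner (y u) (e t) = 0 /\ inner (y u) (f t) = 0).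
  { intros u. rewrite <- Ewe, <- Ewf.
    split; apply hom_perpP; [exact (proj2_sig we)|exact (proj2_sig wf)]. }
  assert (Q1 := inner_const_derive 1 e e t He He (fun s => proj1 (proj2 (H s)))).
  assert (Q2 := inner_const_derive 1 f f t Hf Hf
    (fun s => proj1 (proj2 (proj2 (H s))))).
  assert (Q3 := inner_const_derive 0 e f t He Hf
    (fun s => proj2 (proj2 (proj2 (H s))))).
  rewrite (inner_sym (e t)) in Q1, Q3. rewrite (inner_sym (f t)) in Q2.
  (* Pairing with [e t] and [f t] reads off the coordinates of the component in the plane. *)
  assert (I : forall w k l,
    inner (lincomb 1 (y w) 1 (lincomb k (e t) l (f t))) (e t) = k /\
    inner (lincomb 1 (y w) 1 (lincomb k (e t) l (f t))) (f t) = l).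
  { intros w k l. assert (Sy := hom_perp_smooth p _ y w). destruct (P w) as [P1 P2].
    rewrite !inner_lincomb_l by smooth_tac.
    rewrite (inner_sym (f t) (e t)), O1, O2, O3, P1, P2. lra. }
  apply Hc in Hue. destruct Hue as (a & b & Eu).
  apply Hc in Huf. destruct Huf as (a' & b' & Ev).
  assert (D : forall (T : R -> R) w k l, (fun x => T x - y w x) =
     lincomb k (e t) l (f t) -> T = lincomb 1 (y w) 1 (lincomb k (e t) l (f t))).
  { intros T w k l E. rewrite <- E. apply functional_extensionality; intros x.
    unfold lincomb. ring. }
  apply D in Eu, Ev.
  change (time_derive e t) with (pds e t) in *.
  change (time_derive f t) with (pds f t) in *.
  rewrite Eu in Q1, Q3. rewrite Ev in Q2, Q3.
  rewrite (proj1 (I we a b)) in Q1. rewrite (proj2 (I wf a' b')) in Q2.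
  rewrite (proj2 (I we a b)), (proj1 (I wf a' b')) in Q3.
  exists b. rewrite Eu, Ev.
  (* The constant norms give [2 a = 0] and [2 b' = 0], the constant inner product gives
     [b + a' = 0]. *)
  assert (a = 0) by lra. assert (b' = 0) by lra. assert (a' = - b) by lra. subst.
  split; apply functional_extensionality; intros x; unfold lincomb; ring.
Qed.

Lemma TPhi_tangent_map (r : bool) (p : parity) :
  tangent_map (rescale 2 (GrassmannR r p)) (ImmSimR r p) (Phi r p) (TPhi r p).
Proof.
  intros g t y _ (e & f & Hl & Hy).
  exists (fun s => basic_curve (e s) (f s)).
  split; [now apply frame_lift_normalized_lift|].
  assert (Hl' := Hl). destruct Hl' as (He & Hf & H).
  destruct (Gr0_frame r p (g t) _ _ (H t)) as [B _].
  destruct (basis_carrier r p _ _ _ B) as [Ce Cf].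
  assert (Se : smooth (e t)) by apply B. assert (Sf : smooth (f t)) by apply B.
  set (we := exist _ _ Ce : {u | carrier (proj1_sig (g t)) u}).
  set (wf := exist _ _ Cf : {u | carrier (proj1_sig (g t)) u}).
  destruct (frame_velocity r p g t y e f we wf Hl eq_refl eq_refl
    (proj1 (Hy we) eq_refl) (proj2 (Hy wf) eq_refl)) as (b & E1 & E2).
  rewrite ctime_derive_basic_curve, E1, E2 by assumption.
  set (e0 := frame1 r p (g t)). set (f0 := frame2 r p (g t)).
  destruct (Gr0_frame r p (g t) _ _ (frame12 r p (g t))) as [B0 _].
  fold e0 f0 in B0.
  assert (Se0 : smooth e0) by apply B0. assert (Sf0 : smooth f0) by apply B0.
  destruct (orthonormal_frame_turn r p (proj1_sig (g t)) e0 f0 (e t) (f t)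
    (proj1 (proj2_sig (g t))) (frame12 r p (g t)) (H t))
    as (phi & sigma & Hs & Ee & Ef).
  set (w1 := exist _ _ (frame1_carrier r p (g t)) : {u | carrier (proj1_sig (g t)) u}).
  set (w2 := exist _ _ (frame2_carrier r p (g t)) : {u | carrier (proj1_sig (g t)) u}).
  assert (Q := sign_ok_sqr r sigma Hs).
  assert (Sy := hom_perp_smooth p _ y).
  assert (Y1 : y we = turn1 phi sigma (y w1) (y w2)) by (apply hom_linear; exact Ee).
  assert (Y2 : y wf = turn2 phi sigma (y w1) (y w2)) by (apply hom_linear; exact Ef).
  (* By [E1] and [E2], [dw] differs from the image under [y] by [- i b w], that is [-2 b] times
     [i w / 2], so the curve moves by [-2 b] along its rotation direction; moving this direction
     inside [orth] costs the factor [sigma]. *)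
  exists (orth phi sigma), (- 2 * b * sigma).
  split; [now apply orthogonal_map_orth|]. split.
  - rewrite Ee, Ef. now apply basic_curve_turn.
  - change (wint (e t) (f t) (fun x => y we x + b * f t x) (fun x => y wf x - b * e t x) =
      (fun x => orth phi sigma (wint e0 f0 (y w1) (y w2) x +
        RtoC (- 2 * b * sigma) * rot_dir (basic_curve e0 f0) x)%C)).
    replace (fun x => y we x + b * f t x) with
      (lincomb 1 (y we) (- 2 * b) (lincomb 0 (e t) (- / 2) (f t)))
      by (apply functional_extensionality; intros; unfold lincomb; field).
    replace (fun x => y wf x - b * e t x) with
      (lincomb 1 (y wf) (- 2 * b) (lincomb (/ 2) (e t) 0 (f t)))
      by (apply functional_extensionality; intros; unfold lincomb; field).
    rewrite wint_lin, <- rot_dir_basic_curve by (smooth_tac; apply Sy).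
    rewrite Y1, Y2, Ee, Ef, wint_turn, basic_curve_turn, rot_dir_orth by auto.
    apply functional_extensionality; intros x.
    set (z := wint e0 f0 (y w1) (y w2) x).
    set (k := rot_dir (basic_curve e0 f0) x).
    destruct z as [z1 z2], k as [k1 k2].
    unfold orth, cflip, expi, RtoC, Cmult, Cplus; simpl. f_equal; ring.
Qed.

Theorem mainTheorem2 (r : bool) (p : parity) :
  exists Phi : Gr0 r p -> ImmSim r p,
    induced_by_basic_curve r p Phi /\
    isometry (rescale 2 (GrassmannR r p)) (ImmSimR r p) Phi.
Proof.
  exists (Phi r p). split; [apply Phi_induced|]. split.
  - apply Phi_diffeomorphism.
  - exists (TPhi r p). split; [apply TPhi_tangent_map|].
    intros W y q. apply TPhi_normsq.
Qed.
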